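(* Let $(K,\partial)$ be a $\mathfrak{g}$-field. Then $(K,\partial)$ is existentially closed (in the class of $\mathfrak{g}$-fields, as an $L_{\mathfrak{g}}$-structure) if and only if $(K,\partial)$ satisfies the following geometric axioms: for every positive integer $n$ and all $K$-varieties $V\subseteq \mathbb{A}^n_K$ and $W\subseteq \nabla(V)$, if $c_V(W)\subseteq \nabla(W)$, then there is $a\in V(K)$ such that $\partial_V(a)\in W(K)$.
   Context: Let $\mathbf{k}$ be a field and $\mathfrak{g}=\mathrm{Spec}(H)$ a finite group scheme over $\mathbf{k}$: $H$ is a finite-dimensional commutative Hopf algebra over $\mathbf{k}$ with comultiplication $\mu:H\to H\otimes_{\mathbf{k}}H$ and counit $\pi:H\to\mathbf{k}$; put $e=\dim_{\mathbf{k}}H$. A $\mathfrak{g}$-ring is a $\mathbf{k}$-algebra $R$ with a $\mathbf{k}$-algebra map $\partial:R\to R\otimes_{\mathbf{k}}H$ such that $(\mathrm{id}_R\otimes\pi)\circ\partial=\mathrm{id}_R$ and $(\mathrm{id}_R\otimes\mu)\circ\partial=(\partial\otimes\mathrm{id}_H)\circ\partial$ (equivalently, an action of $\mathfrak{g}$ on $\mathrm{Spec}(R)$); a $\mathfrak{g}$-field is a $\mathfrak{g}$-ring which is a field, and $\mathfrak{g}$-extensions are ring extensions compatible with the maps $\partial$. Fix a $\mathbf{k}$-basis $b_0,\dots,b_{e-1}$ of $H$ with $\pi(b_0)=1$, $\pi(b_i)=0$ for $i>0$, and write $\partial(r)=\sum_i\partial_i(r)\otimes b_i$ (so $\partial_0=\mathrm{id}$).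 $L_{\mathfrak{g}}$ is the language of rings expanded by constants for the elements of $\mathbf{k}$ and unary function symbols for $\partial_1,\dots,\partial_{e-1}$; $\mathfrak{g}$-fields are exactly the models of a suitable $L_{\mathfrak{g}}$-theory. Prolongations: for a $\mathfrak{g}$-field $(K,\partial)$ and a $K$-algebra $R$ (structure map $\iota:K\to R$), $R\otimes^{\partial}_{\mathbf{k}}H$ denotes the ring $R\otimes_{\mathbf{k}}H$ with the $K$-algebra structure $(\iota\otimes\mathrm{id}_H)\circ\partial:K\to R\otimes_{\mathbf{k}}H$. A $K$-variety is a reduced $K$-irreducible closed subvariety of some $\mathbb{A}^n_K$. For a $K$-variety $V$, $\nabla(V)$ is the $K$-variety with functorial identification $\nabla(V)(R)=V(R\otimes^{\partial}_{\mathbf{k}}H)$ for all $K$-algebras $R$ (it exists; $\nabla(\mathbb{A}^n)=\mathbb{A}^{ne}$). Since $\partial:K\to K\otimes^{\partial}_{\mathbf{k}}H$ is a $K$-algebra map, it induces $\partial_V:=V(\partial):V(K)\to\nabla(V)(K)$; in coordinates $\partial_V(a)=(a,\partial_1(a),\dots,\partial_{e-1}(a))$. The map $\mathrm{id}_R\otimes\mu:R\otimes^{\partial}_{\mathbf{k}}H\to(R\otimes^{\partial}_{\mathbf{k}}H)\otimes^{\partial}_{\mathbf{k}}H$ is a $K$-algebra map, and $c_V:\nabla(V)\to\nabla(\nabla(V))$ is the morphism given on $R$-points by $V(\mathrm{id}_R\otimes\mu)$; in coordinates $c_V(x_0,\dots,x_{e-1})=(\sum_{l}c^{i,j}_l x_l)_{i,j<e}$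 where $\mu(b_l)=\sum_{i,j}c^{i,j}_l b_i\otimes b_j$. For $W\subseteq\nabla(V)$, $\nabla(W)$ is viewed as a closed subvariety of $\nabla(\nabla(V))$. *)

(* Defs.v *)
From HB Require Import structures.
From mathcomp Require Import all_boot all_algebra.
From mathcomp Require Import mpoly ring.
From Stdlib Require Import ClassicalEpsilon.

Set Implicit Arguments.
Unset Strict Implicit.
Unset Printing Implicit Defensive.

Import GRing.Theory.
Local Open Scope ring_scope.

#[short(type="finComAlgType")]
HB.structure Definition FinComAlgebra (k : fieldType) :=
  {A of GRing.ComAlgebra k A & Vector k A}.

(* Not assumed finite-dimensional, in contrast with fieldExtType. *)
#[short(type="fieldAlgType")]
HB.structure Definition FieldAlgebra (k : fieldType) :=
  {A of GRing.ComAlgebra k A & GRing.Field A}.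

Record kbasis (k : fieldType) (H : finComAlgType k) (e : nat) := KBasis {
  bvec :> e.-tuple H;
  bvecP : basis_of fullv bvec
}.

(* The k-algebra R (x)_k H in coordinates with respect to a basis b of H: the *)
(* family x stands for \sum_i (x i) (x) b_i. A wrapper is needed because finite *)
(* functions already carry the pointwise ring structure. *)
Record tens (k : fieldType) (H : finComAlgType k) (e : nat) (b : kbasis H e)
    (R : comAlgType k) := MkTens { tcoord : {ffun 'I_e -> R} }.

Definition tens_fun (k : fieldType) (H : finComAlgType k) (e : nat)
    (b : kbasis H e) (R : comAlgType k) (x : tens b R) : 'I_e -> R := tcoord x.
Coercion tens_fun : tens >-> Funclass.
Definition mk_tens (k : fieldType) (H : finComAlgType k) (e : nat)
    (b : kbasis H e) (R : comAlgType k) (f : 'I_e -> R) : tens b R :=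
  MkTens b [ffun i => f i].

Section TensorAlgebra.
Variables (k : fieldType) (H : finComAlgType k) (e : nat) (b : kbasis H e).

(* b_i * b_j = \sum_m (sconst i j m) *: b_m *)
Definition sconst (i j m : 'I_e) : k := coord b m (b`_i * b`_j).

Lemma coord_mul (x y : H) (m : 'I_e) : coord b m (x * y) =
  \sum_i \sum_j coord b i x * coord b j y * sconst i j m.
Proof.
have mf v : v \in <<b>>%VS by rewrite (span_basis (bvecP b)) memvf.
rewrite {1}(coord_span (mf x)) {1}(coord_span (mf y)) mulr_suml linear_sum.
apply: eq_bigr => i _; rewrite mulr_sumr linear_sum; apply: eq_bigr => j _.
by rewrite -scalerAl -scalerAr !linearZ /= mulrA.
Qed.

Lemma coord_nth (i j : 'I_e) : coord b i b`_j = (i == j)%:R.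
Proof. by rewrite coord_free 1?eq_sym ?(basis_free (bvecP b)). Qed.

Variable R : comAlgType k.
Implicit Types x y z : tens b R.

HB.instance Definition _ := [isNew for @tcoord k H e b R].
HB.instance Definition _ := [Choice of tens b R by <:].

Lemma tensP x y : x =1 y <-> x = y.
Proof.
split=> [eq_xy | -> //]; apply: val_inj; apply/ffunP => i; exact: eq_xy.
Qed.

Lemma mk_tensE f i : (mk_tens b f : tens b R) i = f i.
Proof. by rewrite /tens_fun ffunE. Qed.

Definition tens_zero : tens b R := mk_tens b (fun=> 0).
Definition tens_opp x : tens b R := mk_tens b (fun i => - x i).
Definition tens_add x y : tens b R := mk_tens b (fun i => x i + y i).
Definition tens_scale (c : k) x : tens b R := mk_tens b (fun i => c *: x i).
Definition tens_one : tens b R := mk_tens b (fun i => (coord b i 1)%:A).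
Definition tens_mul x y : tens b R :=
  mk_tens b (fun m => \sum_i \sum_j sconst i j m *: (x i * y j)).

Fact tens_addA : associative tens_add.
Proof. by move=> x y z; apply/tensP => i; rewrite !mk_tensE addrA. Qed.
Fact tens_addC : commutative tens_add.
Proof. by move=> x y; apply/tensP => i; rewrite !mk_tensE addrC. Qed.
Fact tens_add0 : left_id tens_zero tens_add.
Proof. by move=> x; apply/tensP => i; rewrite !mk_tensE add0r. Qed.
Fact tens_addN : left_inverse tens_zero tens_opp tens_add.
Proof. by move=> x; apply/tensP => i; rewrite !mk_tensE addNr. Qed.
HB.instance Definition _ := GRing.isZmodule.Build (tens b R)
  tens_addA tens_addC tens_add0 tens_addN.

Lemma tens0E i : (0 : tens b R) i = 0. Proof. exact: mk_tensE. Qed.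
Lemma tensDE x y i : (x + y) i = x i + y i. Proof. exact: mk_tensE. Qed.

Fact tens_scaleA c d x : tens_scale c (tens_scale d x) = tens_scale (c * d) x.
Proof. by apply/tensP => i; rewrite !mk_tensE scalerA. Qed.
Fact tens_scale1 : left_id 1 tens_scale.
Proof. by move=> x; apply/tensP => i; rewrite !mk_tensE scale1r. Qed.
Fact tens_scaleDr : right_distributive tens_scale +%R.
Proof. by move=> c x y; apply/tensP => i; rewrite !(mk_tensE, tensDE) scalerDr. Qed.
Fact tens_scaleDl x : {morph tens_scale^~ x : c d / c + d}.
Proof. by move=> c d; apply/tensP => i; rewrite !(mk_tensE, tensDE) scalerDl. Qed.
HB.instance Definition _ := GRing.Zmodule_isLmodule.Build k (tens b R)
  tens_scaleA tens_scale1 tens_scaleDr tens_scaleDl.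

Lemma tensZE (c : k) x i : (c *: x) i = c *: x i. Proof. exact: mk_tensE. Qed.

Fact tens_mulC : commutative tens_mul.
Proof.
move=> x y; apply/tensP => m; rewrite !mk_tensE exchange_big /=.
by apply: eq_bigr => i _; apply: eq_bigr => j _; rewrite /sconst mulrC [y i * _]mulrC.
Qed.

Lemma sconstA (i j l n : 'I_e) :
  \sum_m sconst i j m * sconst m l n = \sum_m sconst j l m * sconst i m n.
Proof.
transitivity (coord b n (b`_i * b`_j * b`_l)).
  rewrite coord_mul; apply: eq_bigr => m _.
  rewrite (bigD1 l) //= coord_nth eqxx mulr1 big1 ?addr0 // => s /negPf ns.
  by rewrite coord_nth ns mulr0 mul0r.
rewrite -mulrA coord_mul (bigD1 i) //= [X in _ + X]big1 ?addr0.
  by apply: eq_bigr => m _; rewrite coord_nth eqxx mul1r.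
move=> s /negPf ns; apply: big1 => m _.
by rewrite coord_nth ns !mul0r.
Qed.

Fact tens_mulA : associative tens_mul.
Proof.
move=> x y z; apply/tensP => n; rewrite !mk_tensE.
transitivity (\sum_i \sum_j \sum_l
    (\sum_m sconst j l m * sconst i m n) *: (x i * y j * z l)).
  apply: eq_bigr => i _.
  under eq_bigr => m _ do rewrite mk_tensE mulr_sumr scaler_sumr.
  rewrite exchange_big /=; apply: eq_bigr => j _.
  under eq_bigr => m _ do rewrite mulr_sumr scaler_sumr.
  rewrite exchange_big /=; apply: eq_bigr => l _.
  rewrite scaler_suml; apply: eq_bigr => m _.
  by rewrite -scalerAr scalerA mulrA [in LHS]mulrC.
apply: esym.
under eq_bigr => m _ do under eq_bigr => l _ do
  rewrite mk_tensE mulr_suml scaler_sumr.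
rewrite exchange_big /=.
under eq_bigr => l _ do rewrite exchange_big /=.
rewrite exchange_big /=; apply: eq_bigr => i _.
under eq_bigr => l _ do under eq_bigr => m _ do rewrite mulr_suml scaler_sumr.
under eq_bigr => l _ do rewrite exchange_big /=.
rewrite exchange_big /=; apply: eq_bigr => j _; apply: eq_bigr => l _.
rewrite -sconstA scaler_suml; apply: eq_bigr => m _.
by rewrite -scalerAl scalerA [in LHS]mulrC.
Qed.

Fact tens_mul1 : left_id tens_one tens_mul.
Proof.
move=> x; apply/tensP => m; rewrite mk_tensE exchange_big /=.
transitivity (\sum_(j < e) coord b m (1 * b`_j) *: x j).
  apply: eq_bigr => j _; rewrite coord_mul scaler_suml; apply: eq_bigr => i _.
  rewrite mk_tensE -scalerAl mul1r scalerA; congr (_ *: _).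
  rewrite (bigD1 j) //= coord_nth eqxx mulr1 big1 ?addr0 1?mulrC // => s /negPf ns.
  by rewrite coord_nth ns mulr0 mul0r.
rewrite (bigD1 m) //= mul1r coord_nth eqxx scale1r big1 ?addr0 // => s /negPf ns.
by rewrite mul1r coord_nth eq_sym ns scale0r.
Qed.

Fact tens_mulDl : left_distributive tens_mul +%R.
Proof.
move=> x y z; apply/tensP => m; rewrite !(mk_tensE, tensDE) -big_split /=.
apply: eq_bigr => i _; rewrite -big_split /=; apply: eq_bigr => j _.
by rewrite tensDE mulrDl scalerDr.
Qed.

Fact tens_one_neq0 : tens_one != 0.
Proof.
apply/eqP => /tensP one0; have /eqP[] := oner_neq0 H.
rewrite (coord_basis (bvecP b) (memvf 1)) big1 // => i _.
move: (one0 i); rewrite mk_tensE tens0E => /eqP.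
by rewrite scaler_eq0 oner_eq0 orbF => /eqP->; rewrite scale0r.
Qed.

HB.instance Definition _ := GRing.Zmodule_isComNzRing.Build (tens b R)
  tens_mulA tens_mulC tens_mul1 tens_mulDl tens_one_neq0.

Lemma tens1E i : (1 : tens b R) i = (coord b i 1)%:A.
Proof. exact: mk_tensE. Qed.
Lemma tensME x y m : (x * y) m = \sum_i \sum_j sconst i j m *: (x i * y j).
Proof. exact: mk_tensE. Qed.

Fact tens_scaleAl (c : k) x y : c *: (x * y) = c *: x * y.
Proof.
apply/tensP => m; rewrite tensZE !tensME scaler_sumr; apply: eq_bigr => i _.
rewrite scaler_sumr; apply: eq_bigr => j _.
by rewrite tensZE -scalerAl !scalerA mulrC.
Qed.
HB.instance Definition _ :=
  GRing.Lmodule_isLalgebra.Build k (tens b R) tens_scaleAl.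
Fact tens_scaleAr (c : k) x y : c *: (x * y) = x * (c *: y).
Proof. by rewrite mulrC tens_scaleAl mulrC. Qed.
HB.instance Definition _ :=
  GRing.Lalgebra_isAlgebra.Build k (tens b R) tens_scaleAr.

End TensorAlgebra.

Section TensorMaps.
Variables (k : fieldType) (H : finComAlgType k) (e : nat) (b : kbasis H e).
Variable R : comAlgType k.

(* f (x) id_H *)
Definition tens_map (S : comAlgType k) (f : R -> S) (x : tens b R) : tens b S :=
  mk_tens b (fun i => f (x i)).

(* id_R (x) p, with values in R (x)_k k = R *)
Definition tens_eval (p : H -> k) (x : tens b R) : R := \sum_(i < e) p b`_i *: x i.

(* id_R (x) mu, with values in R (x) (H (x) H) = (R (x) H) (x) H; if *)
(* mu b_l = \sum_(i, j) c i j l *: (b_i (x) b_j), then r (x) b_l is mapped to *)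
(* \sum_(i, j) c i j l *: ((r (x) b_i) (x) b_j). *)
Definition tens_comul (mu : H -> tens b H) (x : tens b R) : tens b (tens b R) :=
  mk_tens b (fun j => mk_tens b (fun i => \sum_(l < e) coord b i (mu b`_l j) *: x l)).

Variables (S : comAlgType k) (f : {lrmorphism R -> S}).

Lemma tens_mapE x i : tens_map f x i = f (x i).
Proof. exact: mk_tensE. Qed.

Fact tens_map_is_linear : linear (tens_map f).
Proof.
by move=> c x y; apply/tensP => i; rewrite !(tens_mapE, tensDE, tensZE) linearP.
Qed.
HB.instance Definition _ := GRing.isLinear.Build k (tens b R) (tens b S) _
  (tens_map f) tens_map_is_linear.

Fact tens_map_is_multiplicative : monoid_morphism (tens_map f).
Proof.
split=> [|x y]; apply/tensP => m; rewrite tens_mapE.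
  by rewrite !tens1E linearZ_LR rmorph1.
rewrite !tensME rmorph_sum; apply: eq_bigr => i _; rewrite rmorph_sum.
by apply: eq_bigr => j _; rewrite /= linearZ_LR rmorphM !tens_mapE.
Qed.
HB.instance Definition _ := GRing.isMonoidMorphism.Build (tens b R) (tens b S)
  (tens_map f) tens_map_is_multiplicative.

End TensorMaps.

(* A commutative Hopf algebra structure on H, i.e. the finite group scheme *)
(* Spec H. Each law is spelled out in coordinates: for [comul h] equal to *)
(* \sum_i h_i (x) b_i, [comul h i] is h_i : H. *)
Record hopf (k : fieldType) (H : finComAlgType k) (e : nat) (b : kbasis H e) :=
  Hopf {
  comul : {lrmorphism H -> tens b H};
  counit : {lrmorphism H -> k | *%R};
  antipode : {linear H -> H};
  comulA : forall h, tens_map comul (comul h) = tens_comul comul (comul h);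
  counit_r : forall h, tens_eval counit (comul h) = h;
  counit_l : forall h, \sum_(i < e) counit (comul h i) *: b`_i = h;
  antipode_l : forall h, \sum_(i < e) antipode (comul h i) * b`_i = (counit h)%:A;
  antipode_r : forall h, \sum_(i < e) comul h i * antipode b`_i = (counit h)%:A
}.

(* With \partial r = \sum_i \partial_i r (x) b_i, [coact r i] is \partial_i r. *)
Record gring (k : fieldType) (H : finComAlgType k) (e : nat) (b : kbasis H e)
    (G : hopf b) (R : comAlgType k) := GRingStruct {
  coact :> {lrmorphism R -> tens b R};
  coact_counit : forall r, tens_eval (counit G) (coact r) = r;
  coact_comul : forall r, tens_comul (comul G) (coact r) = tens_map coact (coact r)
}.

Definition gmorphism (k : fieldType) (H : finComAlgType k) (e : nat)
    (b : kbasis H e) (G : hopf b) (R S : comAlgType k) (DR : gring G R)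
    (DS : gring G S) (f : {lrmorphism R -> S}) : Prop :=
  forall r, DS (f r) = tens_map f (DR r).

(* Terms and quantifier-free formulas with variables in X of the language of *)
(* rings with constants for k and d unary function symbols; [LDer i] is the *)
(* symbol of index i + 1. *)
Inductive Lg_term (k : Type) (d : nat) (X : Type) : Type :=
| LVar of X
| LConst of k
| LZero
| LOne
| LAdd of Lg_term k d X & Lg_term k d X
| LOpp of Lg_term k d X
| LMul of Lg_term k d X & Lg_term k d X
| LDer of 'I_d & Lg_term k d X.

Inductive Lg_qf (k : Type) (d : nat) (X : Type) : Type :=
| QFalse
| QEq of Lg_term k d X & Lg_term k d X
| QNot of Lg_qf k d X
| QAnd of Lg_qf k d X & Lg_qf k d X
| QOr of Lg_qf k d X & Lg_qf k d X.

Section ExistentiallyClosed.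
Variables (k : fieldType) (H : finComAlgType k) (d : nat) (b : kbasis H d.+1).
Variable G : hopf b.

Section Semantics.
Variables (K : comAlgType k) (D : gring G K) (X : Type) (v : X -> K).

Fixpoint Lg_eval (t : Lg_term k d X) : K :=
  match t with
  | LVar x => v x
  | LConst c => c%:A
  | LZero => 0
  | LOne => 1
  | LAdd t1 t2 => Lg_eval t1 + Lg_eval t2
  | LOpp t1 => - Lg_eval t1
  | LMul t1 t2 => Lg_eval t1 * Lg_eval t2
  | LDer i t1 => D (Lg_eval t1) (lift ord0 i)
  end.

Fixpoint Lg_holds (phi : Lg_qf k d X) : Prop :=
  match phi with
  | QFalse => False
  | QEq t1 t2 => Lg_eval t1 = Lg_eval t2
  | QNot p => ~ Lg_holds p
  | QAnd p q => Lg_holds p /\ Lg_holds q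
  | QOr p q => Lg_holds p \/ Lg_holds q
  end.
End Semantics.

Definition assign (m p : nat) (K : Type) (x : 'I_m -> K) (a : 'I_p -> K)
    (s : 'I_m + 'I_p) : K :=
  match s with inl i => x i | inr j => a j end.

Definition existentially_closed (K : fieldAlgType k) (D : gring G K) : Prop :=
  forall (L : fieldAlgType k) (DL : gring G L) (f : {lrmorphism K -> L}),
  gmorphism D DL f ->
  forall (m p : nat) (phi : Lg_qf k d ('I_m + 'I_p)) (a : 'I_p -> K),
  (exists x : 'I_m -> L, Lg_holds DL (assign x (f \o a)) phi) ->
  exists x : 'I_m -> K, Lg_holds D (assign x a) phi.

End ExistentiallyClosed.

Section Varieties.
Variables (K : fieldType) (n : nat).
Implicit Types I J : {pred {mpoly K[n]}}.

(* Nonempty reduced closed subschemes of affine n-space, given by their *)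
(* (radical) ideals; [idealr_closed] includes 1 \notin I. *)
Definition reduced_closed I : Prop :=
  idealr_closed I /\ forall (f : {mpoly K[n]}) (m : nat), f ^+ m \in I -> f \in I.

(* The union of two reduced closed subschemes has ideal I(Z1) :&: I(Z2). *)
Definition irreducible I : Prop :=
  forall J1 J2, reduced_closed J1 -> reduced_closed J2 ->
  I =i [predI J1 & J2] -> I =i J1 \/ I =i J2.

Record variety := Variety {
  vanishing :> {pred {mpoly K[n]}};
  variety_reduced : reduced_closed vanishing;
  variety_irreducible : irreducible vanishing
}.

Lemma variety_prime I :
  reduced_closed I /\ irreducible I <-> idealr_closed I /\ prime_idealr_closed I.
Proof.
split=> [[[Iid Irad] Iirr] | [Iid Ipr]]; last first.
  have [I0 I1 IP] := Iid; split.
    split=> // f; elim=> [|m IHm]; first by rewrite expr0 (negPf I1).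
    by rewrite exprS => /Ipr/orP[|/IHm].
  move=> J1 J2 [[_ _ P1] _] [[_ _ P2] _] eqI.
  have IJ f : f \in I -> f \in J1 /\ f \in J2.
    by rewrite eqI => /andP.
  have [IJ1|nIJ1] := classic (forall f, f \in J1 -> f \in I).
    by left=> f; apply/idP/idP => [/IJ[]|/IJ1].
  right=> g; apply/idP/idP => [/IJ[]//|J2g].
  have [f nf] := not_all_ex_not _ _ nIJ1.
  have [J1f /negP nIf] := imply_to_and _ _ nf.
  have : f * g \in I.
    rewrite eqI inE -[f * g]addr0; apply/andP; split; last first.
      by apply: P2 => //; case: (IJ 0 I0).
    by rewrite mulrC; apply: P1 => //; case: (IJ 0 I0).
  by move/Ipr; rewrite (negPf nIf).
split=> // f g Ifg; have [I0 I1 IP] := Iid.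
have IM a u : u \in I -> a * u \in I.
  by move=> Iu; rewrite -[a * u]addr0; apply: IP.
have ID u v : u \in I -> v \in I -> u + v \in I.
  by move=> Iu Iv; rewrite -[u]mul1r; apply: IP.
pose Q h u := exists m a, u ^+ m + a * h \in I.
pose J h : {pred {mpoly K[n]}} :=
  fun u => if excluded_middle_informative (Q h u) then true else false.
have JP h u : reflect (Q h u) (u \in J h).
  by rewrite unfold_in; case: excluded_middle_informative => ?; constructor.
have JI h u : u \in I -> u \in J h.
  by move=> Iu; apply/JP; exists 1%N, 0; rewrite mul0r addr0.
have Jh h : h \in J h.
  by apply/JP; exists 1%N, (-1); rewrite mulN1r subrr.
have Jcl h h' : h * h' \in I -> h' \notin I -> reduced_closed (J h).
  move=> Ihh nIh'; split; last first.
    move=> u m /JP[m' [a Iu]]; apply/JP; exists (m * m')%N, a.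
    by rewrite exprM.
  split; first exact: JI.
    apply: contra nIh' => /JP[m [a]]; rewrite expr1n => Ia.
    have -> : h' = h' * (1 + a * h) + (- a) * (h * h').
      by rewrite mulrDr mulr1 mulNr mulrCA [h' * h]mulrC addrK.
    by apply: ID; apply: IM.
  move=> c u v /JP[m [a Ia]] /JP[m' [a' Ia']].
  suff [r Er] : exists r, (c * u + v) ^+ (m + m') + r * h \in I.
    by apply/JP; exists (m + m')%N, r.
  rewrite exprDn.
  elim/big_rec: _ => [|i y _ [r Ir]]; first by exists 0; rewrite mul0r addr0.
  suff [r' Ir'] : exists r', (c * u) ^+ (m + m' - i) * v ^+ i *+ 'C(m + m', i)
      + r' * h \in I.
    by exists (r' + r); rewrite mulrDl addrACA; apply: ID.
  have [le_im | lt_mi] := leqP m' i.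
    pose s := (c * u) ^+ (m + m' - i) * v ^+ (i - m') *+ 'C(m + m', i).
    exists (s * a'); suff -> : (c * u) ^+ (m + m' - i) * v ^+ i *+ 'C(m + m', i)
        + s * a' * h = s * (v ^+ m' + a' * h) by exact: IM.
    by rewrite mulrDr -mulrA; congr (_ + _); rewrite /s mulrnAl -mulrA -exprD subnK.
  have le_m : (m <= m + m' - i)%N by rewrite -addnBA ?leq_addr // ltnW.
  pose s := c ^+ (m + m' - i) * u ^+ (m + m' - i - m) * v ^+ i *+ 'C(m + m', i).
  exists (s * a); suff -> : (c * u) ^+ (m + m' - i) * v ^+ i *+ 'C(m + m', i)
      + s * a * h = s * (u ^+ m + a * h) by exact: IM.
  rewrite mulrDr -[s * a * h]mulrA; congr (_ + _); rewrite /s exprMn.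
  have -> : u ^+ (m + m' - i) = u ^+ (m + m' - i - m) * u ^+ m.
    by rewrite -exprD subnK.
  by rewrite mulrnAl -!mulrA [u ^+ m * _]mulrC.
have [//|nIf] := boolP (f \in I); rewrite orFb; apply: contraT => nIg.
have Igf : g * f \in I by rewrite mulrC.
have eqI : I =i [predI J f & J g].
  move=> u; apply/idP/idP => [Iu | /andP[/JP[m [a Ia]] /JP[m' [a' Ia']]]].
    by rewrite inE !JI.
  apply: (Irad u (m + m')%N).
  have -> : u ^+ (m + m') = u ^+ m' * (u ^+ m + a * f)
      + ((- (a * f)) * (u ^+ m' + a' * g) + a * a' * (f * g)).
    by rewrite exprD; ring.
  exact: ID (IM _ _ Ia) (ID _ _ (IM _ _ Ia') (IM _ _ Ifg)).
case: (Iirr _ _ (Jcl _ _ Ifg nIg) (Jcl _ _ Igf nIf) eqI) => eqJ.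
  by have := Jh f; rewrite -eqJ (negPf nIf).
by have := Jh g; rewrite -eqJ (negPf nIg).
Qed.

End Varieties.

Section Prolongations.
Variables (k : fieldType) (H : finComAlgType k) (e : nat) (b : kbasis H e).
Variables (G : hopf b) (K : fieldAlgType k) (D : gring G K).

(* Functors of points of closed subschemes of affine n-space over K. Every *)
(* K-algebra is a k-algebra, and its structure map is then k-linear. *)
Definition subfunctor (n : nat) : Type :=
  forall R : comAlgType k, {lrmorphism K -> R} -> 'rV[R]_n -> Prop.

Definition points (n : nat) (V : variety K n) : subfunctor n :=
  fun R iota v => forall f, f \in (V : {pred _}) -> mmap iota (v 0) f = 0.

Definition subfunctor_le (n : nat) (F1 F2 : subfunctor n) : Prop :=
  forall (R : comAlgType k) (iota : {lrmorphism K -> R}) (v : 'rV[R]_n),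
  F1 R iota v -> F2 R iota v.

(* The K-algebra R (x)^D H: the ring R (x)_k H with this structure map. *)
Definition twist (R : comAlgType k) (iota : {lrmorphism K -> R}) :
  {lrmorphism K -> tens b R} := tens_map iota \o D.

(* The identification A^n(R (x) H) = A^(e * n)(R): coordinate [mxvec_index i m] *)
(* is the coefficient at b_i of the m-th coordinate. *)
Definition pack (R : comAlgType k) (n : nat) (w : 'rV[R]_(e * n)) :
  'rV[tens b R]_n := \row_m mk_tens b (fun i => vec_mx w i m).
Definition unpack (R : comAlgType k) (n : nat) (z : 'rV[tens b R]_n) :
  'rV[R]_(e * n) := mxvec (\matrix_(i, m) z 0 m i).

Definition nabla (n : nat) (F : subfunctor n) : subfunctor (e * n) :=
  fun R iota w => F (tens b R) (twist iota) (pack w).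

Definition nabla_point (n : nat) (a : 'rV[K]_n) : 'rV[K]_(e * n) :=
  unpack (map_mx D a).

(* V(id_R (x) mu), which does not depend on V in coordinates. *)
Definition c_map (R : comAlgType k) (n : nat) (w : 'rV[R]_(e * n)) :
  'rV[R]_(e * (e * n)) :=
  unpack (unpack (map_mx (@tens_comul _ _ _ b R (comul G)) (pack w))).

Definition geometric_axioms : Prop :=
  forall (n : nat) (V : variety K n) (W : variety K (e * n)),
  (0 < n)%N ->
  subfunctor_le (points W) (nabla (points V)) ->
  (forall (R : comAlgType k) (iota : {lrmorphism K -> R}) (w : 'rV[R]_(e * n)),
     points W iota w -> nabla (points W) iota (c_map w)) ->
  exists a : 'rV[K]_n,
    points V (idfun : {lrmorphism K -> K}) a /\
    points W (idfun : {lrmorphism K -> K}) (nabla_point a).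

End Prolongations.

(* Main.v *)
From HB Require Import structures.
Require Import Defs.
From mathcomp Require Import all_boot all_order all_algebra.
From mathcomp Require Import mpoly ring.
From Stdlib Require Import ClassicalEpsilon.

(* The coordinate ring A = K[nabla A^n] is itself a g-ring over K, the action *)
(* being given on coordinates by c, and for x in L^n, with L a g-extension of *)
(* K, evaluation at the point nabla x is a morphism of g-rings A -> L. *)
(* (<=) A term t therefore takes at x the value of one element of A, namely t *)
(* interpreted in A. The locus W of nabla x over K satisfies the hypothesis of *)
(* the axioms, so that some nabla a with a in K^n satisfies all the polynomial *)
(* equations of nabla x; an additional coordinate, inverse to a nonzero value, *)
(* takes care of the inequations. *)
(* (=>) The condition c(W) <= nabla W says that the ideal of W is stable under *)
(* the action on A, which then extends to the residue field L = K(W): there *)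
(* D r is invertible in L (x) H for r <> 0, because by the antipode *)
(* r (x) h |-> D r * h is bijective on A (x) H. The generic point of W is some *)
(* nabla x with x in L^n, so that existential closedness yields a zero of the *)
(* finitely many equations of W of the form nabla a with a in K^n. *)

(** The algebra A = K[nabla A^n] is the free g-ring over K on n generators. Its action is
    [poly_gring], its generators are the [generic_coord], and a point x of L^n corresponds to the
    g-morphism of evaluation at nabla x ([nabla_gmorphism], [kmeval_generic_coord]; uniqueness is
    the end of [generic_extension]). Moreover, by [kmeval_poly_coact], the condition c(W) <= nabla W
    says that the ideal of W is stable under the action.

    From the axioms, [geometric_specialization] replaces nabla x by some nabla a that satisfies all
    its equations, and [qf_transfer] reduces a quantifier-free formula to these equations and a
    single inequation.

    In the other direction, the crux is that the action passes to the field K(W) ([loc_gring]).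
    Elements outside the ideal must be sent to units: they stay regular by [tens_map_coact_reg],
    which rests on the bijectivity of the Galois map, and regular elements of a finite-dimensional
    algebra are units ([tens_reg_unit]). Then [generic_extension] gives a solution in K(W), and a
    formula can express W because its ideal is finitely generated ([hilbert_basis],
    [ec_finite_zeros]). *)

Set Implicit Arguments.
Unset Strict Implicit.
Unset Printing Implicit Defensive.

Import GRing.Theory Order.TTheory.
Local Open Scope ring_scope.

(** * The tensor algebra R (x) H *)

Section TensLift.
Variables (k : fieldType) (H : finComAlgType k) (e : nat) (b : kbasis H e).

Lemma basis_sum (h : H) : h = \sum_(i < e) coord b i h *: b`_i.
Proof. exact: coord_basis (bvecP b) (memvf h). Qed.

Lemma tens_sumE (R : comAlgType k) (I : Type) (r : seq I) (P : pred I)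
    (F : I -> tens b R) (j : 'I_e) :
  (\sum_(i <- r | P i) F i) j = \sum_(i <- r | P i) F i j.
Proof.
by elim/big_rec2: _ => [|i y x _ <-]; [exact: tens0E | exact: tensDE].
Qed.

Section Embeddings.
Variable R : comAlgType k.

(** The elements r (x) 1 and, below, 1 (x) h. By [tens_sum] their products span R (x) H, so that
    linear identities are checked on these products. *)
Definition tens_inl (r : R) : tens b R := mk_tens b (fun i => coord b i 1 *: r).
Definition tens_inr (h : H) : tens b R := mk_tens b (fun i => (coord b i h)%:A).

Fact tens_inl_is_linear : linear tens_inl.
Proof.
move=> c x y; apply/tensP => i; rewrite !(mk_tensE, tensDE, tensZE) scalerDr.
by rewrite !scalerA mulrC.
Qed.
HB.instance Definition _ := GRing.isLinear.Build k R (tens b R) _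
  tens_inl tens_inl_is_linear.

Fact tens_inr_is_linear : linear tens_inr.
Proof.
move=> c x y; apply/tensP => i; rewrite !(mk_tensE, tensDE, tensZE).
by rewrite linearP scalerDl scalerA.
Qed.
HB.instance Definition _ := GRing.isLinear.Build k H (tens b R) _
  tens_inr tens_inr_is_linear.

Lemma tens_inl_mulE (r : R) (x : tens b R) i : (tens_inl r * x) i = r * x i.
Proof.
have := congr1 (fun z : tens b R => z i) (mul1r x); rewrite /= tensME => x1.
rewrite -x1 tensME mulr_sumr; apply: eq_bigr => j _.
rewrite mulr_sumr; apply: eq_bigr => l _.
by rewrite mk_tensE tens1E -!scalerAl mul1r -!scalerAr.
Qed.

Fact tens_inl_is_multiplicative : monoid_morphism tens_inl.
Proof.
split=> [|x y]; apply/tensP => i.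
  by rewrite [LHS]mk_tensE tens1E.
by rewrite tens_inl_mulE !mk_tensE scalerAr.
Qed.
HB.instance Definition _ := GRing.isMonoidMorphism.Build R (tens b R)
  tens_inl tens_inl_is_multiplicative.

Fact tens_inr_is_multiplicative : monoid_morphism tens_inr.
Proof.
split=> [|x y]; apply/tensP => m; first by rewrite [LHS]mk_tensE tens1E.
rewrite mk_tensE tensME coord_mul scaler_suml; apply: eq_bigr => i _.
rewrite scaler_suml; apply: eq_bigr => j _.
by rewrite !mk_tensE -scalerAl mul1r !scalerA -[in RHS]mulrA [in RHS]mulrC.
Qed.
HB.instance Definition _ := GRing.isMonoidMorphism.Build H (tens b R)
  tens_inr tens_inr_is_multiplicative.

Lemma tens_sum (x : tens b R) : x = \sum_i tens_inl (x i) * tens_inr b`_i.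
Proof.
apply/tensP => j; rewrite tens_sumE (bigD1 j) //= big1 => [|i /negPf ij].
  by rewrite tens_inl_mulE mk_tensE coord_nth eqxx scale1r mulr1 addr0.
by rewrite tens_inl_mulE mk_tensE coord_nth eq_sym ij scale0r mulr0.
Qed.

End Embeddings.

Section Lift.
Variables (R S : comAlgType k).
Variables (f : {lrmorphism R -> S}) (g : {lrmorphism H -> S}).

(** The universal property of R (x) H as the coproduct of R and H among commutative k-algebras. The
    maps induced by the counit, the comultiplication and an action are all instances, hence algebra
    morphisms. *)
Definition tens_lift (x : tens b R) : S := \sum_i f (x i) * g b`_i.

Fact tens_lift_is_linear : linear tens_lift.
Proof.
move=> c x y; rewrite /tens_lift scaler_sumr -big_split; apply: eq_bigr => i _.
by rewrite /= tensDE tensZE linearP mulrDl scalerAl.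
Qed.
HB.instance Definition _ := GRing.isLinear.Build k (tens b R) S _
  tens_lift tens_lift_is_linear.

Lemma tens_liftE r h : tens_lift (tens_inl r * tens_inr R h) = f r * g h.
Proof.
rewrite [in g h](basis_sum h) linear_sum mulr_sumr; apply: eq_bigr => i _.
rewrite tens_inl_mulE mk_tensE linearZ /= -scalerAr mulr1.
by rewrite !linearZ -scalerAl scalerAr.
Qed.

Lemma tens_lift_inl r : tens_lift (tens_inl r) = f r.
Proof.
by rewrite -[tens_inl r]mulr1 -(rmorph1 (tens_inr R)) tens_liftE rmorph1 mulr1.
Qed.

Lemma tens_lift_inr h : tens_lift (tens_inr R h) = g h.
Proof.
by rewrite -[tens_inr R h]mul1r -(rmorph1 (@tens_inl R)) tens_liftE rmorph1 mul1r.
Qed.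

Fact tens_lift_is_multiplicative : monoid_morphism tens_lift.
Proof.
split=> [|x y]; first by rewrite -(rmorph1 (@tens_inl R)) tens_lift_inl rmorph1.
rewrite [x]tens_sum [y]tens_sum mulr_suml ![tens_lift (\sum_i _)]linear_sum mulr_suml.
apply: eq_bigr => i _; rewrite !mulr_sumr linear_sum.
by apply: eq_bigr => j _; rewrite mulrACA -!rmorphM /= !tens_liftE !rmorphM [RHS]mulrACA.
Qed.
HB.instance Definition _ := GRing.isMonoidMorphism.Build (tens b R) S
  tens_lift tens_lift_is_multiplicative.

End Lift.

Lemma tens_map_inl (R S : comAlgType k) (f : {lrmorphism R -> S}) r :
  tens_map f (tens_inl r) = tens_inl (f r).
Proof. by apply/tensP => i; rewrite !mk_tensE linearZ. Qed.

Lemma tens_map_comp (R S T : comAlgType k) (f : S -> T) (g : R -> S) (x : tens b R) :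
  tens_map f (tens_map g x) = tens_map (f \o g) x.
Proof. by apply/tensP => i; rewrite !mk_tensE. Qed.

Lemma eq_tens_map (R S : comAlgType k) (f g : R -> S) (x : tens b R) :
  f =1 g -> tens_map f x = tens_map g x.
Proof. by move=> fg; apply/tensP => i; rewrite !mk_tensE fg. Qed.

Section Structure.
Variables (G : hopf b) (R : comAlgType k).

Definition counit_alg (h : H) : R := (counit G h)%:A.
Fact counit_alg_is_linear : linear counit_alg.
Proof. by move=> c x y; rewrite /counit_alg linearP scalerDl scalerA. Qed.
HB.instance Definition _ := GRing.isLinear.Build k H R _
  counit_alg counit_alg_is_linear.
Fact counit_alg_is_multiplicative : monoid_morphism counit_alg.
Proof.
split=> [|x y]; rewrite /counit_alg ?rmorph1 ?scale1r //.
by rewrite rmorphM -scalerAl mul1r scalerA.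
Qed.
HB.instance Definition _ := GRing.isMonoidMorphism.Build H R
  counit_alg counit_alg_is_multiplicative.

Lemma tens_evalE : tens_eval (counit G) =1 tens_lift idfun counit_alg.
Proof.
move=> x; apply: eq_bigr => i _.
by rewrite /counit_alg /= -scalerAr mulr1.
Qed.

Lemma tens_comulE : @tens_comul _ _ _ b R (comul G) =1
  tens_lift (@tens_inl (tens b R) \o @tens_inl R)
    (tens_map (tens_inr R) \o comul G).
Proof.
move=> x; apply/tensP => j; apply/tensP => i.
rewrite !mk_tensE !tens_sumE; apply: eq_bigr => l _.
rewrite /= !tens_inl_mulE tens_mapE mk_tensE.
by rewrite -scalerAr mulr1.
Qed.

Fact tens_comul_is_linear : linear (@tens_comul _ _ _ b R (comul G)).
Proof. by move=> c x y; rewrite !tens_comulE linearP. Qed.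
Fact tens_comul_is_multiplicative :
  monoid_morphism (@tens_comul _ _ _ b R (comul G)).
Proof. by split=> [|x y]; rewrite !tens_comulE ?rmorph1 ?rmorphM. Qed.
Fact tens_eval_is_linear : linear (@tens_eval _ _ _ b R (counit G)).
Proof. by move=> c x y; rewrite !tens_evalE linearP. Qed.
Fact tens_eval_is_multiplicative :
  monoid_morphism (@tens_eval _ _ _ b R (counit G)).
Proof. by split=> [|x y]; rewrite !tens_evalE ?rmorph1 ?rmorphM. Qed.

HB.instance Definition _ := GRing.isLinear.Build k (tens b R) (tens b (tens b R)) _
  (@tens_comul _ _ _ b R (comul G)) tens_comul_is_linear.
HB.instance Definition _ := GRing.isMonoidMorphism.Build
  (tens b R) (tens b (tens b R))
  (@tens_comul _ _ _ b R (comul G)) tens_comul_is_multiplicative.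
HB.instance Definition _ := GRing.isLinear.Build k (tens b R) R _
  (@tens_eval _ _ _ b R (counit G)) tens_eval_is_linear.
HB.instance Definition _ := GRing.isMonoidMorphism.Build (tens b R) R
  (@tens_eval _ _ _ b R (counit G)) tens_eval_is_multiplicative.

End Structure.

Lemma tens_map_eval (G : hopf b) (R S : comAlgType k) (f : {lrmorphism R -> S})
    (x : tens b R) :
  tens_eval (counit G) (tens_map f x) = f (tens_eval (counit G) x).
Proof.
rewrite /tens_eval linear_sum; apply: eq_bigr => i _.
by rewrite tens_mapE linearZ.
Qed.

Lemma tens_map_comul (G : hopf b) (R S : comAlgType k) (f : {lrmorphism R -> S})
    (x : tens b R) :
  tens_comul (comul G) (tens_map f x) =
  tens_map (tens_map f) (tens_comul (comul G) x).
Proof.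
apply/tensP => j; apply/tensP => i; rewrite !mk_tensE linear_sum.
by apply: eq_bigr => l _; rewrite tens_mapE linearZ.
Qed.

End TensLift.

(** * The Galois map of an action *)

Section Galois.
Variables (k : fieldType) (H : finComAlgType k) (e : nat) (b : kbasis H e).

Section Mapr.
Variables (R : comAlgType k) (T : {linear H -> H}).

(** The map id_R (x) T. It is only linear, as is the antipode recorded in [hopf]; this suffices for
    a two-sided inverse of [galois]. *)
Definition tens_mapr (x : tens b R) : tens b R :=
  \sum_i tens_inl b (x i) * tens_inr b R (T b`_i).

Fact tens_mapr_is_linear : linear tens_mapr.
Proof.
move=> c x y; rewrite /tens_mapr scaler_sumr -big_split; apply: eq_bigr => i _.
by rewrite /= tensDE tensZE linearP mulrDl scalerAl.
Qed.
HB.instance Definition _ := GRing.isLinear.Build k (tens b R) (tens b R) _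
  tens_mapr tens_mapr_is_linear.

Lemma tens_maprE r h :
  tens_mapr (tens_inl b r * tens_inr b R h) = tens_inl b r * tens_inr b R (T h).
Proof.
rewrite [in RHS](basis_sum b h) !linear_sum mulr_sumr; apply: eq_bigr => i _.
rewrite tens_inl_mulE mk_tensE -scalerAr mulr1 !linearZ /=.
by rewrite -scalerAl scalerAr.
Qed.

End Mapr.

Variables (G : hopf b) (R : comAlgType k) (D : gring G R).

(* On points, (x, g) |-> (g x, g), whence the inverse given by the antipode. *)
Definition galois : tens b R -> tens b R := tens_lift D (tens_inr b R).
HB.instance Definition _ := GRing.LRMorphism.on galois.

Definition galois_inv (x : tens b R) : tens b R :=
  \sum_i tens_mapr (antipode G) (D (x i)) * tens_inr b R b`_i.

Fact galois_inv_is_linear : linear galois_inv.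
Proof.
move=> c x y; rewrite /galois_inv scaler_sumr -big_split; apply: eq_bigr => i _.
by rewrite /= tensDE tensZE !linearP mulrDl scalerAl.
Qed.
HB.instance Definition _ := GRing.isLinear.Build k (tens b R) (tens b R) _
  galois_inv galois_inv_is_linear.

Lemma galois_invE r h : galois_inv (tens_inl b r * tens_inr b R h) =
  tens_mapr (antipode G) (D r) * tens_inr b R h.
Proof.
rewrite [in RHS](basis_sum b h) linear_sum mulr_sumr; apply: eq_bigr => i _.
rewrite tens_inl_mulE mk_tensE -scalerAr mulr1 !linearZ /=.
by rewrite -scalerAl scalerAr.
Qed.

(** Coassociativity of the action, read at the coefficient of b_l in the outer copy of H. *)
Lemma coact_coact r l :
  D (D r l) = \sum_p tens_inl b (D r p) * tens_inr b R (comul G b`_p l).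
Proof.
rewrite -tens_mapE -coact_comul; apply/tensP => i.
rewrite !mk_tensE tens_sumE; apply: eq_bigr => p _.
by rewrite tens_inl_mulE mk_tensE -scalerAr mulr1.
Qed.

Lemma coact_counit_sum r :
  \sum_p tens_inl b (D r p) * tens_inr b R (counit G b`_p)%:A = tens_inl b r.
Proof.
rewrite -[in RHS](coact_counit D r) /tens_eval linear_sum.
by apply: eq_bigr => p _; rewrite !linearZ /= rmorph1 -scalerAr mulr1.
Qed.

(** By coassociativity the left side is the sum over p of D_p r (x) m(id (x) S)(mu b_p), where m is
    the product of H and S the antipode. The antipode axiom turns this into the sum of D_p r (x)
    pi(b_p), which is r (x) 1 by the counit law. The next lemma is the same computation with S on
    the other factor. *)
Lemma galois_mapr r : galois (tens_mapr (antipode G) (D r)) = tens_inl b r.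
Proof.
rewrite linear_sum /= /galois.
under eq_bigr => l _ do rewrite tens_liftE coact_coact mulr_suml.
rewrite exchange_big -[RHS]coact_counit_sum; apply: eq_bigr => p _ /=.
rewrite -antipode_r linear_sum mulr_sumr; apply: eq_bigr => l _ /=.
by rewrite -mulrA -rmorphM.
Qed.

Lemma mapr_inl r :
  \sum_i tens_mapr (antipode G) (D (D r i)) * tens_inr b R b`_i = tens_inl b r.
Proof.
under eq_bigr => l _ do rewrite coact_coact linear_sum mulr_suml.
rewrite exchange_big -[RHS]coact_counit_sum; apply: eq_bigr => p _ /=.
rewrite -antipode_l linear_sum mulr_sumr; apply: eq_bigr => l _ /=.
by rewrite tens_maprE -mulrA -rmorphM.
Qed.

Lemma galois_invK : cancel galois_inv galois.
Proof.
move=> x; rewrite linear_sum [RHS]tens_sum; apply: eq_bigr => i _ /=.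
by rewrite rmorphM /= galois_mapr; congr (_ * _); apply: tens_lift_inr.
Qed.

Lemma galoisK : cancel galois galois_inv.
Proof.
move=> x; rewrite linear_sum [RHS]tens_sum; apply: eq_bigr => i _ /=.
rewrite [D _]tens_sum mulr_suml linear_sum /= -mapr_inl mulr_suml.
apply: eq_bigr => l _ /=.
by rewrite -!mulrA -!rmorphM /= galois_invE.
Qed.

Lemma galois_inl r : galois (tens_inl b r) = D r.
Proof. exact: tens_lift_inl. Qed.

Section Kernel.
Variables (S : comAlgType k) (g : {lrmorphism R -> S}).
Hypothesis kerD : forall r, g r = 0 -> tens_map g (D r) = 0 :> tens b S.

Lemma galois_ker x :
  tens_map g x = 0 :> tens b S -> tens_map g (galois x) = 0 :> tens b S.
Proof.
move=> /tensP gx; rewrite linear_sum big1 // => i _.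
by rewrite rmorphM /= kerD ?mul0r // -(tens_mapE (b := b)) gx tens0E.
Qed.

Lemma galois_inv_ker x :
  tens_map g x = 0 :> tens b S -> tens_map g (galois_inv x) = 0 :> tens b S.
Proof.
move=> /tensP gx; rewrite linear_sum big1 // => i _.
rewrite rmorphM /= linear_sum big1 ?mul0r // => l _.
rewrite rmorphM /= tens_map_inl -(tens_mapE (b := b)).
by rewrite kerD ?tens0E ?linear0 ?mul0r // -(tens_mapE (b := b)) gx tens0E.
Qed.

(** Writing x as [galois y], the product D a * x is the image of (a (x) 1) * y. Both [galois] and
    its inverse preserve the kernel of g (x) id, and a (x) 1 acts modulo this kernel coordinatewise,
    through the regular element g a. *)
Lemma tens_map_coact_reg a x : GRing.lreg (g a) ->
  tens_map g (D a * x) = 0 :> tens b S -> tens_map g x = 0 :> tens b S.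
Proof.
move=> ga Dax; rewrite -(galois_invK x); apply: galois_ker.
have /galois_inv_ker :
    tens_map g (galois (tens_inl b a * galois_inv x)) = 0 :> tens b S.
  by rewrite rmorphM /= galois_inl galois_invK.
rewrite galoisK rmorphM /= tens_map_inl => /tensP a0; apply/tensP => i.
by apply: ga; rewrite tens0E mulr0 -tens_inl_mulE a0 tens0E.
Qed.

End Kernel.

End Galois.

(** * Extension of an action to a field of fractions *)

Section Localization.
Variables (k : fieldType) (H : finComAlgType k) (e : nat) (b : kbasis H e).

(** Multiplication by u is an injective endomorphism of a finite-dimensional L-space, hence
    surjective; M is its matrix in the basis 1 (x) b_j. *)
Lemma tens_reg_unit (L : fieldAlgType k) (u : tens b L) :
  (forall x, u * x = 0 -> x = 0) -> exists v, u * v = 1.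
Proof.
move=> ureg; pose M := \matrix_(j < e, m < e) (u * tens_inr b L b`_j) m.
have ME (v : 'rV[L]_e) m : (u * mk_tens b (v 0)) m = (v *m M) 0 m.
  rewrite [mk_tens b _]tens_sum mulr_sumr tens_sumE mxE; apply: eq_bigr => j _.
  by rewrite mulrCA tens_inl_mulE !mxE mk_tensE.
have Mfree : row_free M.
  rewrite -kermx_eq0; apply/rowV0P => v /sub_kermxP vM0.
  have /tensP v0 : mk_tens b (v 0) = 0 :> tens b L.
    by apply: ureg; apply/tensP => m; rewrite ME vM0 mxE tens0E.
  by apply/rowP => i; rewrite mxE -(tens0E b L i) -v0 mk_tensE.
pose v1 := (\row_m (1 : tens b L) m) *m invmx M.
exists (mk_tens b (v1 0)); apply/tensP => m.
by rewrite ME mulmxKV -?row_free_unit // mxE.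
Qed.

Variables (G : hopf b) (R : comAlgType k) (D : gring G R) (L : fieldAlgType k).
Variable g : {lrmorphism R -> L}.
Hypothesis kerD : forall r, g r = 0 -> tens_map g (D r) = 0 :> tens b L.
Hypothesis fracL : forall z, exists r s, g s != 0 /\ z * g s = g r.

Let T (r : R) : tens b L := tens_map g (D r).
HB.instance Definition _ := GRing.LRMorphism.copy T (tens_map g \o D).

Lemma common_denominator (x : tens b L) :
  exists s (y : tens b R), g s != 0 /\ tens_map g y = tens_inl b (g s) * x.
Proof.
have /fin_all_exists [r rP] i := fracL (x i).
have /fin_all_exists [s sP] := rP.
exists (\prod_i s i), (mk_tens b (fun i => r i * \prod_(j | j != i) s j)); split.
  by rewrite rmorph_prod prodf_seq_neq0; apply/allP => i _; have [] := sP i.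
apply/tensP => i; have [_ si] := sP i.
rewrite tens_mapE tens_inl_mulE mk_tensE [in RHS](bigD1 i) //= !rmorphM /= -si.
by ring.
Qed.

Lemma coact_reg s x : g s != 0 -> T s * x = 0 -> x = 0.
Proof.
move=> gs Tsx; have [c [y [gc yE]]] := common_denominator x.
have /tensP y0 : tens_map g y = 0 :> tens b L.
  apply: (tens_map_coact_reg (a := s) kerD); first exact: mulfI.
  by rewrite rmorphM /= yE mulrCA Tsx mulr0.
apply/tensP => i; apply: (mulfI gc).
by rewrite tens0E mulr0 -(tens_inl_mulE (b := b)) -yE y0 tens0E.
Qed.

Lemma coact_cancel s x y : g s != 0 -> x * T s = y * T s -> x = y.
Proof.
move=> gs /eqP; rewrite -subr_eq0 -mulrBl mulrC => /eqP /(coact_reg gs) /eqP.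
by rewrite subr_eq0 => /eqP.
Qed.

Lemma eq_coact r r' : g r = g r' -> T r = T r'.
Proof.
move=> grr; apply/eqP; rewrite -subr_eq0 -linearB; apply/eqP/kerD.
by rewrite linearB /= grr subrr.
Qed.

(** The value at r/s is forced to be D r * (D s)^-1. Quantifying over all fractions that represent z
    makes independence of the choice part of the statement. *)
Fact loc_coact_subproof z :
  exists y, forall r s, g s != 0 -> z * g s = g r -> y * T s = T r.
Proof.
have [r0 [s0 [gs0 zE]]] := fracL z.
have [v vP] : exists v, T s0 * v = 1.
  by apply: tens_reg_unit => x; apply: coact_reg.
exists (T r0 * v) => r s gs zE'.
have -> : T r0 * v * T s = T (r0 * s) * v by rewrite rmorphM /= mulrAC.
have -> : T (r0 * s) = T (r * s0).
  by apply: eq_coact; rewrite !rmorphM /= -zE -zE'; ring.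
by rewrite rmorphM /= -mulrA vP mulr1.
Qed.

Definition loc_coact z : tens b L :=
  sval (constructive_indefinite_description _ (loc_coact_subproof z)).

Lemma loc_coactP z r s : g s != 0 -> z * g s = g r -> loc_coact z * T s = T r.
Proof.
by rewrite /loc_coact; case: constructive_indefinite_description => y; apply.
Qed.

Lemma loc_coactE r : loc_coact (g r) = T r.
Proof.
rewrite -[LHS]mulr1 -(rmorph1 T) (loc_coactP (r := r)) //.
  by rewrite rmorph1 oner_neq0.
by rewrite rmorph1 mulr1.
Qed.

Fact loc_coact_is_linear : linear loc_coact.
Proof.
move=> c x y; have [r [s [gs xE]]] := fracL x; have [r' [s' [gs' yE]]] := fracL y.
have gss : g (s * s') != 0 by rewrite rmorphM mulf_neq0.
apply: (coact_cancel gss); rewrite (loc_coactP (r := c *: (r * s') + r' * s)) //.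
  rewrite linearP /= !rmorphM /= -(loc_coactP gs xE) -(loc_coactP gs' yE).
  rewrite mulrDl -!scalerAl.
  by congr (c *: _ + _); ring.
rewrite linearP /= !rmorphM /= -xE -yE mulrDl -!scalerAl.
by congr (c *: _ + _); ring.
Qed.
HB.instance Definition _ := GRing.isLinear.Build k L (tens b L) _
  loc_coact loc_coact_is_linear.

Fact loc_coact_is_multiplicative : monoid_morphism loc_coact.
Proof.
split=> [|x y]; first by rewrite -(rmorph1 g) loc_coactE rmorph1.
have [r [s [gs xE]]] := fracL x; have [r' [s' [gs' yE]]] := fracL y.
have gss : g (s * s') != 0 by rewrite rmorphM mulf_neq0.
apply: (coact_cancel gss); rewrite (loc_coactP (r := r * r')) //.
  by rewrite !rmorphM /= -(loc_coactP gs xE) -(loc_coactP gs' yE); ring.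
by rewrite !rmorphM /= -xE -yE; ring.
Qed.
HB.instance Definition _ := GRing.isMonoidMorphism.Build L (tens b L)
  loc_coact loc_coact_is_multiplicative.

Fact loc_coact_counit z : tens_eval (counit G) (loc_coact z) = z.
Proof.
have [r [s [gs zE]]] := fracL z; apply: (mulIf gs).
have TE t : tens_eval (counit G) (T t) = g t by rewrite tens_map_eval coact_counit.
by rewrite -[g s in LHS]TE -rmorphM /= (loc_coactP gs zE) TE.
Qed.

Fact loc_coact_comul z :
  tens_comul (comul G) (loc_coact z) = tens_map loc_coact (loc_coact z).
Proof.
have [r [s [gs zE]]] := fracL z.
have TE t : tens_comul (comul G) (T t) = tens_map loc_coact (T t).
  rewrite tens_map_comul coact_comul !tens_map_comp.
  by apply: eq_tens_map => x /=; rewrite loc_coactE.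
have [v vP] : exists v, T s * v = 1.
  by apply: tens_reg_unit => x; apply: coact_reg.
have -> : loc_coact z = T r * v by rewrite -(loc_coactP gs zE) -mulrA vP mulr1.
(* Two ring morphisms that agree on the unit T s agree on its inverse v. *)
have vE : tens_comul (comul G) v = tens_map loc_coact v.
  rewrite -[LHS]mulr1 -(rmorph1 (tens_map loc_coact)) -vP rmorphM /= -TE mulrA.
  by rewrite -rmorphM /= [v * _]mulrC vP rmorph1 mul1r.
by rewrite !rmorphM /= TE vE.
Qed.

Definition loc_gring : gring G L := GRingStruct loc_coact_counit loc_coact_comul.

Lemma loc_gmorphism : gmorphism D loc_gring g.
Proof. exact: loc_coactE. Qed.

End Localization.

(** * Residue fields and restriction of scalars *)

Section ResidueField.
Local Open Scope quotient_scope.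
Variables (A : comNzRingType) (I : prime_idealr A).

Definition prime_quot : Type := {ideal_quot I}.
HB.instance Definition _ := GRing.ComNzRing.copy prime_quot {ideal_quot I}.

(** The field of fractions is built over an integral domain equipped with an inverse; in A/I
    invertibility is decided classically. *)
Definition prime_quot_unit : pred prime_quot :=
  fun x => if excluded_middle_informative (exists y, y * x = 1) then true else false.
Definition prime_quot_inv (x : prime_quot) : prime_quot :=
  if excluded_middle_informative (exists y, y * x = 1) is left ex
  then sval (constructive_indefinite_description _ ex) else x.

Fact prime_quot_mulVx : {in prime_quot_unit, left_inverse 1 prime_quot_inv *%R}.
Proof.
move=> x; rewrite unfold_in /prime_quot_unit /prime_quot_inv.
case: excluded_middle_informative => // ex _.
by case: constructive_indefinite_description.
Qed.
Fact prime_quot_unitPl (x y : prime_quot) : y * x = 1 -> prime_quot_unit x.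
Proof.
rewrite /prime_quot_unit => yx; case: excluded_middle_informative => // [[]].
by exists y.
Qed.
Fact prime_quot_inv_out : {in [predC prime_quot_unit], prime_quot_inv =1 id}.
Proof.
move=> x; rewrite !inE unfold_in /prime_quot_unit /prime_quot_inv.
by case: excluded_middle_informative.
Qed.
HB.instance Definition _ := GRing.ComNzRing_hasMulInverse.Build prime_quot
  prime_quot_mulVx prime_quot_unitPl prime_quot_inv_out.
HB.instance Definition _ := GRing.ComUnitRing_isIntegral.Build prime_quot
  (@Quotient.rquot_IdomainAxiom A I).

Definition to_residue (a : A) : {fraction prime_quot} :=
  FracField.tofrac (\pi_({ideal_quot I}) a : prime_quot).
HB.instance Definition _ := GRing.RMorphism.copy to_residue
  (@FracField.tofrac prime_quot \o (\pi_({ideal_quot I}) : A -> prime_quot)).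

Lemma to_residue_eq0 a : (to_residue a == 0) = (a \in I).
Proof.
rewrite /to_residue tofrac_eq0 -[in RHS](subr0 a) Quotient.idealrBE.
by rewrite -[X in _ == X](rmorph0 (\pi_({ideal_quot I}))).
Qed.

Lemma residue_frac z :
  exists a a', to_residue a' != 0 /\ z * to_residue a' = to_residue a.
Proof.
elim/quotW: z => -[[n d] /= d0].
exists (repr (n : {ideal_quot I})), (repr (d : {ideal_quot I})).
rewrite /to_residue !reprK tofrac_eq0; split=> //.
unlock FracField.tofrac; rewrite -[LHS]FracField.pi_mul; apply/eqmodP.
rewrite /= FracField.equivfE /FracField.mulf !numden_Ratio ?oner_neq0 ?mulr1 //=.
by rewrite mulrC.
Qed.
End ResidueField.

(** A copy of R whose type remembers phi, so that the k-algebra structure defined by phi can be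
    attached to it. *)
Definition scalar_restriction (k : fieldType) (R : comNzRingType)
  (phi : {rmorphism k -> R}) : Type := R.

Section ScalarRestriction.
Variables (k : fieldType) (R : comNzRingType) (phi : {rmorphism k -> R}).

Local Notation S := (scalar_restriction phi).
HB.instance Definition _ := GRing.ComNzRing.copy S R.

Definition restr_scale (c : k) (x : S) : S := phi c * (x : R).
Fact restr_scaleA c d x :
  restr_scale c (restr_scale d x) = restr_scale (c * d) x.
Proof. by rewrite /restr_scale rmorphM mulrA. Qed.
Fact restr_scale1 : left_id 1 restr_scale.
Proof. by move=> x; rewrite /restr_scale rmorph1 mul1r. Qed.
Fact restr_scaleDr : right_distributive restr_scale +%R.
Proof. by move=> c x y; rewrite /restr_scale mulrDr. Qed.
Fact restr_scaleDl x : {morph restr_scale^~ x : c d / c + d}.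
Proof. by move=> c d; rewrite /restr_scale rmorphD mulrDl. Qed.
HB.instance Definition _ := GRing.Zmodule_isLmodule.Build k S
  restr_scaleA restr_scale1 restr_scaleDr restr_scaleDl.
Fact restr_scaleAl (c : k) (x y : S) : c *: (x * y) = c *: x * y.
Proof. exact: mulrA. Qed.
HB.instance Definition _ := GRing.Lmodule_isLalgebra.Build k S restr_scaleAl.
Fact restr_scaleAr (c : k) (x y : S) : c *: (x * y) = x * (c *: y).
Proof. exact: mulrCA. Qed.
HB.instance Definition _ := GRing.Lalgebra_isAlgebra.Build k S restr_scaleAr.

End ScalarRestriction.
HB.instance Definition _ (k F : fieldType) (phi : {rmorphism k -> F}) :=
  GRing.Field.copy (scalar_restriction phi) F.

Lemma residue_field (k : fieldType) (A : comAlgType k) (I : {pred A}) :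
  idealr_closed I -> prime_idealr_closed I ->
  exists (L : fieldAlgType k) (g : {lrmorphism A -> L}),
    (forall a, (g a == 0) = (a \in I)) /\
    forall z, exists r s, g s != 0 /\ z * g s = g r.
Proof.
move=> Iid Ipr.
pose J : prime_idealr A :=
  HB.pack (I : A -> bool) (isIdealr.Build A I Iid) (isPrimeIdealrClosed.Build A I Ipr).
pose phi : {rmorphism k -> {fraction (prime_quot J)}} := to_residue J \o in_alg A.
pose L : fieldAlgType k := scalar_restriction phi.
pose g0 : A -> L := to_residue J.
have g0Z : scalable g0.
  by move=> c x; rewrite -mulr_algl; apply: (rmorphM (to_residue J)).
pose g : {lrmorphism A -> L} := HB.pack g0 (GRing.RMorphism.on (to_residue J))
  (GRing.isScalable.Build k A L *:%R g0 g0Z).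
exists L, g; split; first exact: to_residue_eq0.
exact: residue_frac.
Qed.

(** * Prolongations as polynomial algebras with an action *)

Section PolynomialAlgebra.
Variables (k : fieldType) (K : fieldAlgType k) (n : nat).

(** Polynomials over K as a k-algebra, by restriction of scalars along k -> K -> K[X], since tensor
    products with H are taken over k. *)
Definition kmpoly : Type :=
  scalar_restriction (@mpolyC n K \o in_alg K : {rmorphism k -> {mpoly K[n]}}).
HB.instance Definition _ := GRing.ComAlgebra.copy kmpoly
  (scalar_restriction (@mpolyC n K \o in_alg K : {rmorphism k -> {mpoly K[n]}})).

Lemma kmpoly_scaleE (c : k) (p : kmpoly) : c *: p = (c%:A%:MP : {mpoly K[n]}) * p.
Proof. by []. Qed.

Definition kmpolyC (c : K) : kmpoly := c%:MP.
HB.instance Definition _ := GRing.RMorphism.copy kmpolyC (@mpolyC n K).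
Fact kmpolyC_is_scalable : scalable kmpolyC.
Proof.
move=> c x; rewrite kmpoly_scaleE /kmpolyC -mpolyCM; congr (_%:MP).
by rewrite -scalerAl mul1r.
Qed.
HB.instance Definition _ := GRing.isScalable.Build k K kmpoly *:%R
  kmpolyC kmpolyC_is_scalable.

Definition kmpolyX (i : 'I_n) : kmpoly := 'X_i.

Section Eval.
Variables (R : comAlgType k) (f : {lrmorphism K -> R}) (v : 'I_n -> R).

Definition kmeval (p : kmpoly) : R := mmap f v p.
HB.instance Definition _ := GRing.RMorphism.copy kmeval (mmap f v).
Fact kmeval_is_scalable : scalable kmeval.
Proof.
have fA c : f c%:A = c%:A by rewrite linearZ_LR rmorph1.
move=> c p; rewrite kmpoly_scaleE /kmeval rmorphM /= mmapC [X in X * _]fA.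
by rewrite -scalerAl mul1r.
Qed.
HB.instance Definition _ := GRing.isScalable.Build k kmpoly R *:%R
  kmeval kmeval_is_scalable.

Lemma kmevalC c : kmeval (kmpolyC c) = f c. Proof. exact: mmapC. Qed.
Lemma kmevalX i : kmeval (kmpolyX i) = v i.
Proof. by rewrite /kmeval /kmpolyX mmapX mmap1U. Qed.

End Eval.

Lemma kmpoly_ext (R : comAlgType k) (f g : {lrmorphism kmpoly -> R}) :
  (forall c, f (kmpolyC c) = g (kmpolyC c)) ->
  (forall i, f (kmpolyX i) = g (kmpolyX i)) -> f =1 g.
Proof.
move=> fgC fgX p; elim/mpolyind: p => [|c m p _ _ IHp]; first by rewrite !rmorph0.
have -> : c *: 'X_[m] + p = kmpolyC c * 'X_[m] + p :> kmpoly.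
  by rewrite -mul_mpolyC.
rewrite !rmorphD !rmorphM /= fgC IHp; congr (_ * _ + _).
rewrite mpolyXE_id (rmorph_prod f) (rmorph_prod g).
by apply: eq_bigr => i _; rewrite !rmorphXn /= fgX.
Qed.

End PolynomialAlgebra.
Arguments kmpolyC {k K n}.
Arguments kmpolyX {k K n}.

Section Comultiplication.
Variables (k : fieldType) (H : finComAlgType k) (e : nat) (b : kbasis H e).
Variable G : hopf b.

Lemma tens_comul_coord (R : comAlgType k) (x : tens b R) j i :
  tens_comul (comul G) x j i = \sum_(l < e) coord b i (comul G b`_l j) *: x l.
Proof. by rewrite !mk_tensE. Qed.

Variable R : comAlgType k.


(** The inner index is contracted, so this is the law [counit_l]; contraction of the outer index is
    [tens_eval_comul], which uses [counit_r]. *)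
Lemma tens_comul_counit (x : tens b R) :
  tens_map (tens_eval (counit G)) (tens_comul (comul G) x) = x.
Proof.
apply/tensP => j; rewrite tens_mapE /= /tens_eval.
transitivity (\sum_(l < e) coord b j b`_l *: x l); last first.
  rewrite (bigD1 j) //= coord_nth eqxx scale1r big1 ?addr0 // => l /negPf lj.
  by rewrite coord_nth eq_sym lj scale0r.
under eq_bigr => i _ do rewrite tens_comul_coord scaler_sumr.
rewrite exchange_big; apply: eq_bigr => l _ /=.
under eq_bigr => i _ do rewrite scalerA.
rewrite -scaler_suml; congr (_ *: _).
rewrite -[in RHS](counit_l G b`_l) linear_sum /= [in RHS](bigD1 j) //= linearZ /=.
rewrite coord_nth eqxx mulr1 [X in _ = _ + X]big1 ?addr0.
  rewrite {2}(basis_sum b (comul G b`_l j)) linear_sum; apply: eq_bigr => i _.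
  by rewrite linearZ /= mulrC.
by move=> i /negPf ij; rewrite linearZ /= coord_nth eq_sym ij mulr0.
Qed.

Lemma tens_comulA (x : tens b R) :
  tens_map (tens_comul (comul G)) (tens_comul (comul G) x) =
  tens_comul (comul G) (tens_comul (comul G) x).
Proof.
apply/tensP => j; apply/tensP => i'; apply/tensP => i.
rewrite tens_mapE /= !tens_comul_coord tens_sumE.
under eq_bigr => l _ do rewrite tens_comul_coord scaler_sumr.
under [RHS]eq_bigr => l _ do rewrite tensZE tens_comul_coord scaler_sumr.
rewrite exchange_big [RHS]exchange_big; apply: eq_bigr => p _ /=.
under eq_bigr => l _ do rewrite scalerA.
under [RHS]eq_bigr => l _ do rewrite scalerA.
rewrite -!scaler_suml; congr (_ *: _).
transitivity (coord b i (comul G (comul G b`_p j) i')).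
  rewrite {2}(basis_sum b (comul G b`_p j)) linear_sum tens_sumE linear_sum.
  by apply: eq_bigr => l _; rewrite linearZ /= tensZE linearZ /= mulrC.
rewrite -tens_mapE comulA !mk_tensE linear_sum.
by apply: eq_bigr => l _; rewrite linearZ.
Qed.

Lemma pack_unpack m (z : 'rV[tens b R]_m) : pack b (unpack z) = z.
Proof.
by apply/rowP => j; apply/tensP => i; rewrite !mxE mk_tensE mxvecK mxE.
Qed.

Lemma packE m (w : 'rV[R]_(e * m)) j i : pack b w 0 j i = w 0 (mxvec_index i j).
Proof. by rewrite mxE mk_tensE mxE. Qed.

Lemma pack_c_map m (w : 'rV[R]_(e * m)) i j :
  pack b (c_map G w) 0 (mxvec_index i j) = tens_comul (comul G) (pack b w 0 j) i.
Proof. by rewrite pack_unpack mxvecE !mxE. Qed.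

End Comultiplication.

Section Prolong.
Variables (k : fieldType) (H : finComAlgType k) (e : nat) (b : kbasis H e).
Variables (G : hopf b) (K : fieldAlgType k) (D : gring G K) (n : nat).
Local Notation A := (kmpoly K (e * n)).

Definition generic : 'rV[A]_(e * n) := \row_i kmpolyX i.

(** A K-morphism A -> A (x)^D H is an A-point of nabla(nabla A^n); this one is the image under c of
    the generic point of nabla A^n. *)
Definition poly_coact : A -> tens b A :=
  kmeval (twist D kmpolyC) (pack b (c_map G generic) 0).
HB.instance Definition _ := GRing.LRMorphism.on poly_coact.

Lemma poly_coactC c : poly_coact (kmpolyC c) = tens_map kmpolyC (D c).
Proof. exact: kmevalC. Qed.

Lemma poly_coactX i j : poly_coact (kmpolyX (mxvec_index i j)) =
  tens_comul (comul G) (pack b generic 0 j) i.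
Proof. by rewrite /poly_coact kmevalX pack_c_map. Qed.

Lemma poly_coact_pack j :
  tens_map poly_coact (pack b generic 0 j) = tens_comul (comul G) (pack b generic 0 j).
Proof. by apply/tensP => i; rewrite tens_mapE packE mxE /= poly_coactX. Qed.

Fact poly_coact_counit p : tens_eval (counit G) (poly_coact p) = p.
Proof.
apply: (kmpoly_ext (f := tens_eval (counit G) \o poly_coact) (g := idfun)) => [c|i] /=.
  by rewrite poly_coactC tens_map_eval coact_counit.
case/mxvec_indexP: i => i j; rewrite poly_coactX -tens_mapE tens_comul_counit.
by rewrite packE mxE.
Qed.

Fact poly_coact_comul p :
  tens_comul (comul G) (poly_coact p) = tens_map poly_coact (poly_coact p).
Proof.
apply: (kmpoly_ext (f := tens_comul (comul G) \o poly_coact)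
  (g := tens_map poly_coact \o poly_coact)) => [c|i] /=.
  rewrite poly_coactC tens_map_comul coact_comul !tens_map_comp.
  by apply: eq_tens_map => x /=; rewrite poly_coactC.
case/mxvec_indexP: i => i j; rewrite poly_coactX.
rewrite -[RHS](tens_mapE (tens_map poly_coact)) -tens_map_comul poly_coact_pack.
by rewrite -tens_comulA tens_mapE.
Qed.

Definition poly_gring : gring G A := GRingStruct poly_coact_counit poly_coact_comul.

(** Naturality of c. If w is a point of W, the right side is the value of p at c(w): this translates
    c(W) <= nabla W into stability of the ideal of W. *)
Lemma kmeval_poly_coact (R : comAlgType k) (f : {lrmorphism K -> R})
    (w : 'rV[R]_(e * n)) p :
  tens_map (kmeval f (w 0)) (poly_coact p) =
  kmeval (twist D f) (pack b (c_map G w) 0) p.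
Proof.
apply: (kmpoly_ext (f := tens_map (kmeval f (w 0)) \o poly_coact)
  (g := kmeval (twist D f) (pack b (c_map G w) 0))) => [c|i] /=.
  rewrite kmevalC poly_coactC tens_map_comp.
  by apply: eq_tens_map => x /=; rewrite kmevalC.
case/mxvec_indexP: i => i j; rewrite poly_coactX kmevalX pack_c_map.
rewrite -[LHS](tens_mapE (tens_map _)) -tens_map_comul; congr (tens_comul _ _ _).
by apply/tensP => l; rewrite tens_mapE !packE mxE /= kmevalX.
Qed.

(* The coordinates of [weil p] are the equations of the Weil restriction of p = 0. *)
Definition weil (p : kmpoly K n) : tens b A :=
  kmeval (twist D kmpolyC) (pack b generic 0) p.

Lemma kmeval_weil (R : comAlgType k) (f : {lrmorphism K -> R})
    (w : 'rV[R]_(e * n)) (p : kmpoly K n) :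
  tens_map (kmeval f (w 0)) (weil p) = kmeval (twist D f) (pack b w 0) p.
Proof.
apply: (kmpoly_ext (f := tens_map (kmeval f (w 0)) \o
    kmeval (twist D kmpolyC) (pack b generic 0))
  (g := kmeval (twist D f) (pack b w 0))) => [c|j] /=.
  rewrite !kmevalC tens_map_comp.
  by apply: eq_tens_map => x /=; rewrite kmevalC.
rewrite !kmevalX; apply/tensP => l.
by rewrite tens_mapE !packE mxE /= kmevalX.
Qed.

Variables (L : fieldAlgType k) (DL : gring G L) (f : {lrmorphism K -> L}).
Hypothesis fD : gmorphism D DL f.
Implicit Types x : 'rV[L]_n.

Lemma nabla_pointE x i j : nabla_point DL x 0 (mxvec_index i j) = DL (x 0 j) i.
Proof. by rewrite mxvecE !mxE. Qed.

Lemma pack_nabla x : pack b (nabla_point DL x) = map_mx DL x.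
Proof. exact: pack_unpack. Qed.

(** Coassociativity of the action on L says that c(nabla x) = nabla(nabla x). *)
Lemma nabla_gmorphism x :
  gmorphism poly_gring DL (kmeval f (nabla_point DL x 0)).
Proof.
move=> p; rewrite [RHS]kmeval_poly_coact.
apply: (kmpoly_ext (f := DL \o kmeval f (nabla_point DL x 0))
  (g := kmeval (twist D f) (pack b (c_map G (nabla_point DL x)) 0))) => [c|i] /=.
  by rewrite !kmevalC fD.
case/mxvec_indexP: i => i j; rewrite !kmevalX nabla_pointE pack_c_map.
by rewrite pack_nabla mxE coact_comul tens_mapE.
Qed.

Lemma kmeval_nabla x (p : kmpoly K n) :
  kmeval (twist D f) (pack b (nabla_point DL x) 0) p = DL (kmeval f (x 0) p).
Proof.
apply: (kmpoly_ext (f := kmeval (twist D f) (pack b (nabla_point DL x) 0))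
  (g := DL \o kmeval f (x 0))) => [c|j] /=.
  by rewrite !kmevalC fD.
by rewrite !kmevalX pack_nabla mxE.
Qed.

End Prolong.

(** * Hilbert's basis theorem *)

Section HilbertBasis.

(** Each new index is chosen where u is minimal on the remaining tail. *)
Lemma nondecreasing_subsequence (u : nat -> nat) :
  exists2 phi : nat -> nat, {homo phi : i j / i < j}%N &
    {homo u \o phi : i j / i < j >-> i <= j}%N.
Proof.
have argmin N : exists i, (N <= i)%N /\ forall j, (N <= j)%N -> (u i <= u j)%N.
  suff H m : forall i, (N <= i)%N -> (u i <= m)%N ->
      exists i, (N <= i)%N /\ forall j, (N <= j)%N -> (u i <= u j)%N.
    exact: (H (u N) N).
  elim: m => [|m IHm] i Ni ui.
    by exists i; split=> // j _; move: ui; rewrite leqn0 => /eqP->.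
  have [[j [Nj uj]]|nex] := classic (exists j, (N <= j)%N /\ (u j <= m)%N).
    exact: (IHm j).
  exists i; split=> // j Nj; apply: leq_trans ui _; rewrite ltnNge.
  by apply/negP => uj; apply: nex; exists j.
pose f N := sval (constructive_indefinite_description _ (argmin N)).
have fP N : (N <= f N)%N /\ forall j, (N <= j)%N -> (u (f N) <= u j)%N.
  by rewrite /f; case: constructive_indefinite_description.
pose phi := fix phi n := if n is m.+1 then f (phi m).+1 else f 0.
have phiS i : (phi i < phi i.+1)%N by have [] := fP (phi i).+1.
exists phi; first exact: (homo_ltn (r := fun x y => (x < y)%N) ltn_trans).
apply: (homo_ltn (r := fun x y => (x <= y)%N) leq_trans) => i /=.
case: i (phiS i) => [|i] lti; apply: (fP _).2 => //.
by apply/ltnW/(leq_ltn_trans _ lti); have [] := fP (phi i).+1.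
Qed.

Lemma mnm_good_pair n (u : nat -> 'X_{1..n}) :
  exists i j, (i < j)%N /\ (u i <= u j)%MM.
Proof.
suff /(_ (enum 'I_n)) [phi phiI phiP] : forall s : seq 'I_n,
    exists2 phi : nat -> nat, {homo phi : i j / i < j}%N &
      forall c, c \in s -> {homo (fun i => u (phi i) c) : i j / i < j >-> i <= j}%N.
  exists (phi 0), (phi 1); split; first exact: phiI.
  by apply/mnm_lepP => c; apply: phiP; rewrite ?mem_enum.
(* The coordinates are treated one at a time, each by a further extraction of a subsequence. *)
elim=> [|c s [phi phiI phiP]]; first by exists id.
have [psi psiI psiP] := nondecreasing_subsequence (fun i => u (phi i) c).
exists (phi \o psi) => [i j ij|c']; first exact/phiI/psiI.
rewrite inE => /predU1P[->|sc'] i j ij; first exact: psiP.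
exact/phiP/psiI.
Qed.

(** Otherwise one could choose forever an element of S above none of the previous ones,
    contradicting [mnm_good_pair]. *)
Lemma dickson n (S : 'X_{1..n} -> Prop) : exists s : seq 'X_{1..n},
  (forall m, m \in s -> S m) /\ forall m, S m -> exists2 m', m' \in s & (m' <= m)%MM.
Proof.
apply: NNPP => nex.
have next (s : seq 'X_{1..n}) : exists m, (forall m', m' \in s -> S m') ->
    S m /\ forall m', m' \in s -> ~~ (m' <= m)%MM.
  have [Ss|nSs] := classic (forall m', m' \in s -> S m'); last by exists 0%MM.
  apply: NNPP => nm; apply: nex; exists s; split=> // m Sm.
  apply: NNPP => nm'; apply: nm; exists m => _; split=> // m' sm'.
  by apply/negP => le_m; apply: nm'; exists m'.
pose f s := sval (constructive_indefinite_description _ (next s)).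
have fP s : (forall m', m' \in s -> S m') ->
    S (f s) /\ forall m', m' \in s -> ~~ (m' <= f s)%MM.
  by rewrite /f; case: constructive_indefinite_description.
pose s := fix s i := if i is j.+1 then f (s j) :: s j else [::].
have sS i : forall m, m \in s i -> S m.
  by elim: i => //= i IHi m; rewrite inE => /predU1P[->|/IHi//]; apply: (fP _ IHi).1.
have ss i j : (i < j)%N -> f (s i) \in s j.
  elim: j => //= j IHj; rewrite ltnS leq_eqVlt inE.
  by case/predU1P=> [->|/IHj->]; rewrite ?eqxx ?orbT.
have [i [j [lt_ij]]] := mnm_good_pair (f \o s).
by apply/negP/((fP _ (sS j)).2)/ss.
Qed.

(** Dickson's lemma gives finitely many elements of I whose leading monomials divide every leading
    monomial of I. Division by them leaves remainder 0, by well-founded induction on the monomial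
    order. *)
Lemma hilbert_basis (K : fieldType) n (I : {pred {mpoly K[n]}}) :
  (forall a, {in I &, forall u v, a * u + v \in I}) ->
  exists gs : seq {mpoly K[n]}, {subset gs <= I} /\
    forall p, p \in I -> exists c : nat -> {mpoly K[n]},
      p = \sum_(i < size gs) c i * gs`_i.
Proof.
move=> Icl.
have [s [sP sle]] := dickson (fun m => exists2 p, p != 0 & p \in I /\ mlead p = m).
have ex m : exists p, m \in s -> p != 0 /\ (p \in I /\ mlead p = m).
  have [/sP[p p0 Ip]|/negP nsm] := boolP (m \in s); first by exists p.
  by exists 0 => sm; case: nsm.
pose g m := sval (constructive_indefinite_description _ (ex m)).
have gP m : m \in s -> g m != 0 /\ (g m \in I /\ mlead (g m) = m).
  by rewrite /g; case: constructive_indefinite_description.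
exists [seq g m | m <- s]; split=> [_ /mapP[m /gP[_ [Ig _]] ->] //|].
suff H m p : p \in I -> mlead p = m -> exists c : nat -> {mpoly K[n]},
    p = \sum_(i < size [seq g m | m <- s]) c i * [seq g m | m <- s]`_i.
  by move=> p Ip; apply: H Ip erefl.
elim/(well_founded_induction (@ltom_wf n)): m p => m IHm p Ip pm.
have [->|p0] := eqVneq p 0.
  by exists (fun=> 0); rewrite big1 // => i _; rewrite mul0r.
have [m' sm' le_m] : exists2 m', m' \in s & (m' <= m)%MM.
  by apply: sle; exists p.
have [g0 [Ig gm']] := gP _ sm'.
(* The product [a * g m'] has the same leading term as p, so that the remainder q vanishes or has a
   smaller leading monomial. *)
pose a := (mleadc p / mleadc (g m')) *: 'X_[(m - m')] : {mpoly K[n]}.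
have a0 : mleadc p / mleadc (g m') != 0 by rewrite mulf_neq0 ?invr_eq0 ?mleadc_eq0.
pose q := p - a * g m'.
have aX : mlead a = (m - m')%MM by rewrite mleadZ ?mleadXm.
have mE : m = (mlead a + mlead (g m'))%MM by rewrite aX gm' submK.
have Iq : q \in I by rewrite /q addrC -mulNr; apply: Icl.
have qm : q@_m = 0.
  rewrite mcoeffB [in X in _ - X]mE mleadcM mleadcZE mleadXm mcoeffX eqxx mulr1.
  by rewrite divfK ?mleadc_eq0 // pm subrr.
have le_q : (mlead q <= m)%O.
  apply: le_trans (mleadB_le _ _) _; rewrite leUx pm lexx /=.
  by rewrite [X in (_ <= X)%O]mE mleadM_le.
have [c cE] : exists c : nat -> {mpoly K[n]},
    q = \sum_(i < size [seq g m | m <- s]) c i * [seq g m | m <- s]`_i.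
  have [->|q0] := eqVneq q 0.
    by exists (fun=> 0); rewrite big1 // => i _; rewrite mul0r.
  apply: (IHm (mlead q)) => //; rewrite lt_neqAle le_q andbT.
  by apply/eqP => qE; move: q0; rewrite -mleadc_eq0 qE qm eqxx.
have lt_i : (index m' s < size [seq g m | m <- s])%N by rewrite size_map index_mem.
exists (fun i => if i == index m' s then a + c i else c i).
rewrite -[p](subrK (a * g m')) -/q cE (bigD1 (Ordinal lt_i)) //=.
rewrite [RHS](bigD1 (Ordinal lt_i)) //= eqxx mulrDl.
rewrite (nth_map 0%MM) ?index_mem // nth_index //.
rewrite [LHS]addrC addrA; congr (_ + _); apply: eq_bigr => i.
by rewrite -val_eqE /= => /negPf->.
Qed.
End HilbertBasis.

(** * The geometric axioms imply existential closedness *)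

Section Transfer.
Variables (k : fieldType) (H : finComAlgType k) (d : nat) (b : kbasis H d.+1).
Variable G : hopf b.

Lemma Lg_eval_morph (R S : comAlgType k) (DR : gring G R) (DS : gring G S)
    (g : {lrmorphism R -> S}) (X : Type) (v : X -> R) (w : X -> S) :
  gmorphism DR DS g -> (forall s, w s = g (v s)) ->
  forall t, Lg_eval DS w t = g (Lg_eval DR v t).
Proof.
move=> gD wE; elim=> [s|c|||t IHt u IHu|t IHt|t IHt u IHu|i t IHt] /=.
- exact: wE.
- by rewrite linearZ_LR rmorph1.
- by rewrite rmorph0.
- by rewrite rmorph1.
- by rewrite rmorphD IHt IHu.
- by rewrite rmorphN IHt.
- by rewrite rmorphM IHt IHu.
- by rewrite IHt gD tens_mapE.
Qed.

(* [g] is the product of the values in A of the atoms that are false at [x]. *)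
Lemma qf_transfer (A : comAlgType k) (DA : gring G A) (L : fieldAlgType k)
    (DL : gring G L) (ev : {lrmorphism A -> L}) (X : Type) (s : X -> A)
    (x : X -> L) (phi : Lg_qf k d X) :
  gmorphism DA DL ev -> (forall i, x i = ev (s i)) ->
  exists2 g, ev g != 0 &
    forall (K : fieldAlgType k) (DK : gring G K) (ev' : {lrmorphism A -> K})
      (y : X -> K),
      gmorphism DA DK ev' -> (forall i, y i = ev' (s i)) ->
      (forall p, ev p = 0 -> ev' p = 0) -> ev' g != 0 ->
      Lg_holds DL x phi <-> Lg_holds DK y phi.
Proof.
move=> evD xE; elim: phi =>
  [|t u|phi [g g0 IH]|phi [g g0 IH] psi [g' g0' IH']|phi [g g0 IH] psi [g' g0' IH']] /=.
- by exists 1; rewrite ?rmorph1 ?oner_neq0.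
- pose p := Lg_eval DA s t - Lg_eval DA s u.
  have teq K (DK : gring G K) (ev' : {lrmorphism A -> K}) y :
      gmorphism DA DK ev' -> (forall i, y i = ev' (s i)) ->
      (Lg_eval DK y t = Lg_eval DK y u) <-> ev' p = 0.
    move=> evD' yE; rewrite !(Lg_eval_morph evD' yE) /p rmorphB /=.
    by split=> [->|/eqP]; [rewrite subrr | rewrite subr_eq0 => /eqP].
  (* An equation true at x persists by the inclusion of kernels; a false one stays false as soon as
     p is among the factors of g. *)
  have [p0|p0] := eqVneq (ev p) 0.
    exists 1 => [|K DK ev' y evD' yE ker _]; first by rewrite rmorph1 oner_neq0.
    by rewrite (teq _ _ _ _ evD xE) (teq _ _ _ _ evD' yE); split=> // _; apply: ker.
  exists p => // K DK ev' y evD' yE _ p0'.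
  by rewrite (teq _ _ _ _ evD xE) (teq _ _ _ _ evD' yE); split=> /eqP;
    rewrite ?(negPf p0) ?(negPf p0').
- by exists g => // K DK ev' y evD' yE ker /(IH _ _ _ _ evD' yE ker) ->.
- exists (g * g') => [|K DK ev' y evD' yE ker]; first by rewrite rmorphM mulf_neq0.
  rewrite rmorphM mulf_eq0 negb_or => /andP[/(IH _ _ _ _ evD' yE ker)-> ].
  by move=> /(IH' _ _ _ _ evD' yE ker)->.
- exists (g * g') => [|K DK ev' y evD' yE ker]; first by rewrite rmorphM mulf_neq0.
  rewrite rmorphM mulf_eq0 negb_or => /andP[/(IH _ _ _ _ evD' yE ker)-> ].
  by move=> /(IH' _ _ _ _ evD' yE ker)->.
Qed.

Variables (K : fieldAlgType k) (D : gring G K).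
Local Notation e := d.+1.

(** The j-th coordinate of A^n pulled back along the projection nabla A^n -> A^n, which is induced
    by the counit. *)
Definition generic_coord n (j : 'I_n) : kmpoly K (e * n) :=
  tens_eval (counit G) (pack b (generic e K n) 0 j).

Lemma kmeval_generic_coord n (L : fieldAlgType k) (DL : gring G L)
    (f : {lrmorphism K -> L}) (x : 'rV[L]_n) j :
  kmeval f (nabla_point DL x 0) (generic_coord j) = x 0 j.
Proof.
rewrite -[RHS](coact_counit DL) -tens_map_eval; congr tens_eval.
by apply/tensP => i; rewrite tens_mapE packE mxE /= kmevalX nabla_pointE.
Qed.

Section Locus.
Variables (n : nat) (L : fieldAlgType k) (f : {lrmorphism K -> L}) (x : 'rV[L]_n).

Definition locus_ideal : {pred {mpoly K[n]}} := fun p => kmeval f (x 0) p == 0.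

Fact locus_ideal_prime :
  idealr_closed locus_ideal /\ prime_idealr_closed locus_ideal.
Proof.
split; last by move=> p q; rewrite !unfold_in /= /kmeval rmorphM mulf_eq0.
split=> [||a p q]; rewrite !unfold_in /= /kmeval ?rmorph0 ?rmorph1 ?oner_eq0 //.
by move=> /eqP p0 /eqP q0; rewrite rmorphD rmorphM /= p0 q0 mulr0 addr0.
Qed.

Definition locus : variety K n :=
  Variety (proj2 (variety_prime _) locus_ideal_prime).1
    (proj2 (variety_prime _) locus_ideal_prime).2.
End Locus.

Definition restrict_last (S : Type) n (x : 'rV[S]_n.+1) : 'rV[S]_n :=
  \row_j x 0 (lift ord_max j).

(** The comorphism of nabla of the projection A^(n+1) -> A^n that forgets the last coordinate. *)
Definition lift_poly n : kmpoly K (e * n) -> kmpoly K (e * n.+1) :=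
  kmeval kmpolyC
    (mxvec (\matrix_(i < e, j < n) kmpolyX (mxvec_index i (lift ord_max j))) 0).

Lemma kmeval_lift_poly n (L : fieldAlgType k) (DL : gring G L)
    (f : {lrmorphism K -> L}) (x : 'rV[L]_n.+1) p :
  kmeval f (nabla_point DL x 0) (lift_poly p) =
  kmeval f (nabla_point DL (restrict_last x) 0) p.
Proof.
apply: (kmpoly_ext (f := kmeval f (nabla_point DL x 0) \o kmeval kmpolyC
    (mxvec (\matrix_(i < e, j < n) kmpolyX (mxvec_index i (lift ord_max j))) 0))
  (g := kmeval f (nabla_point DL (restrict_last x) 0))) => [c|i] /=.
  by rewrite !kmevalC.
case/mxvec_indexP: i => i j.
by rewrite !kmevalX mxvecE mxE kmevalX !nabla_pointE mxE.
Qed.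

Fact idfun_gmorphism : gmorphism D D idfun.
Proof. by move=> r; apply/tensP => i; rewrite tens_mapE. Qed.

(** The axioms are applied to the loci V of x and W of nabla x over K. If p(x) = 0 then D(p(x)) = 0,
    whence W <= nabla V; evaluation at nabla x is a g-morphism, so its kernel is stable, whence c(W)
    <= nabla W. *)
Lemma geometric_specialization n (L : fieldAlgType k) (DL : gring G L)
    (f : {lrmorphism K -> L}) (x : 'rV[L]_n) :
  geometric_axioms D -> (0 < n)%N -> gmorphism D DL f ->
  exists a : 'rV[K]_n, forall p : kmpoly K (e * n),
    kmeval f (nabla_point DL x 0) p = 0 ->
    kmeval idfun (nabla_point D a 0) p = 0.
Proof.
move=> geomD n0 fD.
have [||a [_ aW]] := geomD n (locus f x) (locus f (nabla_point DL x)) n0.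
- move=> R iota w wW p /eqP px.
  rewrite -[LHS]/(kmeval (twist D iota) (pack b w 0) p) -(kmeval_weil D iota w).
  apply/tensP => i; rewrite tens_mapE tens0E.
  apply: wW; apply/eqP; rewrite -(tens_mapE (b := b)) kmeval_weil.
  by rewrite (kmeval_nabla fD) px rmorph0 tens0E.
- move=> R iota w wW p /eqP px.
  rewrite -[LHS]/(kmeval (twist D iota) (pack b (c_map G w) 0) p).
  rewrite -(kmeval_poly_coact D iota w); apply/tensP => i; rewrite tens_mapE tens0E.
  apply: wW; apply/eqP; rewrite -(tens_mapE (b := b)).
  by have := nabla_gmorphism fD x p; rewrite /= px rmorph0 => <-; rewrite tens0E.
by exists a => p px; apply: aW; apply/eqP.
Qed.

Lemma geometric_existentially_closed :
  geometric_axioms D -> existentially_closed D.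
Proof.
move=> geomD L DL f fD m p phi a [x xphi].
pose s (i : 'I_m + 'I_p) : kmpoly K (e * m) :=
  match i with inl j => generic_coord j | inr j => kmpolyC (a j) end.
pose x1 := \row_j x j.
have xE i : assign x (f \o a) i = kmeval f (nabla_point DL x1 0) (s i).
  case: i => j /=; first by rewrite kmeval_generic_coord mxE.
  by rewrite kmevalC.
have [g g0 gP] := qf_transfer phi (nabla_gmorphism fD x1) xE.
(* Rabinowitsch's trick: the inverse of g(nabla x) becomes a last coordinate. The dimension m + 1 is
   positive even when the formula has no quantified variable. *)
pose y := (kmeval f (nabla_point DL x1 0) g)^-1.
pose x2 : 'rV[L]_m.+1 := \row_i (if unlift ord_max i is Some j then x j else y).
have x2E : restrict_last x2 = x1 by apply/rowP => j; rewrite !mxE liftK.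
have [c cP] := geometric_specialization x2 geomD (ltn0Sn m) fD.
exists ((restrict_last c) 0).
apply/(gP K D (kmeval idfun (nabla_point D (restrict_last c) 0))) => //.
- exact: (nabla_gmorphism idfun_gmorphism).
- by case=> j /=; [rewrite kmeval_generic_coord | rewrite kmevalC].
- move=> q qx; rewrite /= -kmeval_lift_poly; apply: cP.
  by rewrite kmeval_lift_poly x2E.
apply/negP => /eqP gc0.
(* The equation g * (last coordinate) = 1 specializes to c, so that g cannot vanish there. *)
have : kmeval f (nabla_point DL x2 0) (lift_poly g * generic_coord ord_max - 1) = 0.
  rewrite rmorphB rmorphM /= rmorph1 kmeval_lift_poly kmeval_generic_coord x2E.
  by rewrite mxE unlift_none mulfV ?subrr.
move=> /cP; rewrite rmorphB rmorphM /= rmorph1 kmeval_lift_poly gc0 mul0r sub0r.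
by move/eqP; rewrite oppr_eq0 oner_eq0.
Qed.
End Transfer.

(** * Existential closedness implies the geometric axioms *)

Section Existence.
Variables (k : fieldType) (H : finComAlgType k) (d : nat) (b : kbasis H d.+1).
Variable G : hopf b.
Local Notation e := d.+1.

Lemma tens_eval_comul (R : comAlgType k) (x : tens b R) :
  tens_eval (counit G) (tens_comul (comul G) x) = x.
Proof.
apply/tensP => i; rewrite /tens_eval tens_sumE.
transitivity (\sum_(l < e) coord b i b`_l *: x l); last first.
  rewrite (bigD1 i) //= coord_nth eqxx scale1r big1 ?addr0 // => l /negPf li.
  by rewrite coord_nth eq_sym li scale0r.
under eq_bigr => j _ do rewrite tensZE tens_comul_coord scaler_sumr.
rewrite exchange_big; apply: eq_bigr => l _ /=.
under eq_bigr => j _ do rewrite scalerA.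
rewrite -scaler_suml; congr (_ *: _).
rewrite -[in RHS](counit_r G b`_l) /tens_eval linear_sum.
by apply: eq_bigr => j _; rewrite linearZ.
Qed.

Hypothesis counit_b0 : counit G b`_0 = 1.
Hypothesis counit_b : forall i : 'I_d, counit G b`_i.+1 = 0.

Lemma coact0 (R : comAlgType k) (D : gring G R) r : D r ord0 = r.
Proof.
rewrite -[RHS](coact_counit D) /tens_eval big_ord_recl /= counit_b0 scale1r.
by rewrite big1 ?addr0 // => i _; rewrite counit_b scale0r.
Qed.

Variables (K : fieldAlgType k) (D : gring G K).

Section Terms.
Variables (n : nat) (cs : seq K).

Local Notation term := (Lg_term k d ('I_n + 'I_(size cs).+1)).

(** The language has no symbol for the component of index 0, which is the identity by [coact0]; the
    bare variable stands for it. *)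
Definition nabla_term : 'rV[term]_(e * n) :=
  mxvec (\matrix_(i < e, j < n)
    (if unlift ord0 i is Some i' then LDer i' (LVar k d (inl j))
     else LVar k d (inl j))).

(** Each coefficient of p becomes a parameter, found by its position in [cs]. The extra slot makes
    the index type nonempty, as [inord] requires. *)
Definition poly_term (p : {mpoly K[e * n]}) : term :=
  \big[@LAdd _ _ _/LZero k d _]_(m <- msupp p)
     LMul (LVar k d (inr (inord (index p@_m cs))))
       (\big[@LMul _ _ _/LOne k d _]_i iter (m i) (LMul (nabla_term 0 i)) (LOne k d _)).

Lemma poly_termE (L : fieldAlgType k) (DL : gring G L) (f : {lrmorphism K -> L})
    (x : 'I_n -> L) (p : {mpoly K[e * n]}) :
  {subset [seq p@_m | m <- msupp p] <= cs} ->
  Lg_eval DL (assign x (f \o (fun i => cs`_i))) (poly_term p) =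
  kmeval f (nabla_point DL (\row_j x j) 0) p.
Proof.
move=> pcs; rewrite (big_morph (Lg_eval DL _) (id1 := 0) (op1 := +%R)) //.
rewrite /kmeval /mmap !big_seq; apply: eq_bigr => m pm /=.
have mcs : p@_m \in cs by apply/pcs/map_f.
rewrite inordK ?ltnS ?index_size // nth_index //; congr (_ * _).
rewrite (big_morph (Lg_eval DL _) (id1 := 1) (op1 := *%R)) //.
apply: eq_bigr => i _; rewrite -[RHS]mulr1.
elim: (m i) => [|c IHc] /=; first by rewrite expr0 mulr1.
rewrite IHc exprS mulrA; congr (_ * _ * _).
case/mxvec_indexP: i {IHc} => i j; rewrite mxvecE mxE nabla_pointE mxE.
by case: unliftP => [i' -> //|->] /=; rewrite coact0.
Qed.
End Terms.

Lemma Lg_holds_bigand (R : comAlgType k) (DR : gring G R) (X : Type) (v : X -> R)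
    (T : eqType) (s : seq T) (F : T -> Lg_qf k d X) :
  Lg_holds DR v (\big[@QAnd _ _ _/QNot (QFalse k d X)]_(i <- s) F i) <->
  forall i, i \in s -> Lg_holds DR v (F i).
Proof.
elim: s => [|i s IHs]; first by rewrite big_nil; split=> //= _ [].
rewrite big_cons /= IHs; split=> [[Fi Fs] j|Fs].
  by rewrite inE => /predU1P[->|/Fs].
by split=> [|j sj]; apply: Fs; rewrite inE ?eqxx ?sj ?orbT.
Qed.

Lemma ec_finite_zeros n (gs : seq {mpoly K[e * n]}) (L : fieldAlgType k) (DL : gring G L)
    (f : {lrmorphism K -> L}) (x : 'rV[L]_n) :
  existentially_closed D -> gmorphism D DL f ->
  (forall p, p \in gs -> kmeval f (nabla_point DL x 0) p = 0) ->
  exists a : 'rV[K]_n, forall p, p \in gs -> kmeval idfun (nabla_point D a 0) p = 0.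
Proof.
move=> ecD fD xgs.
pose cs := flatten [seq [seq p@_m | m <- msupp p] | p : {mpoly K[e * n]} <- gs].
have cs_sub p : p \in gs -> {subset [seq p@_m | m <- msupp p] <= cs}.
  move=> gp c pc; apply/flattenP; exists [seq p@_m | m <- msupp p] => //.
  by apply/mapP; exists p.
pose phi := \big[@QAnd _ _ _/QNot (QFalse k d _)]_(p <- gs)
  QEq (poly_term cs p) (LZero k d _).
have [|a aphi] := ecD L DL f fD n _ phi (fun i => cs`_i).
  exists (x 0); apply/Lg_holds_bigand => p gp /=.
  rewrite poly_termE; last exact: cs_sub.
  have -> : \row_j x 0 j = x by apply/rowP => j; rewrite mxE.
  exact: xgs.
exists (\row_j a j) => p gp.
rewrite -(poly_termE (cs := cs)); last exact: cs_sub.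
by have /Lg_holds_bigand/(_ p gp) := aphi.
Qed.

(** L is the function field K(W), w its generic point and x the image of the generators of A. *)
Lemma generic_extension n (W : variety K (e * n)) :
  (forall (R : comAlgType k) (iota : {lrmorphism K -> R}) (w : 'rV[R]_(e * n)),
     points W iota w -> nabla D (points W) iota (c_map G w)) ->
  exists (L : fieldAlgType k) (DL : gring G L) (f : {lrmorphism K -> L}) (x : 'rV[L]_n),
    gmorphism D DL f /\ forall p, p \in (W : {pred _}) ->
      kmeval f (nabla_point DL x 0) p = 0.
Proof.
move=> Wc.
have [Wid Wpr] := proj1 (variety_prime _)
  (conj (variety_reduced W) (@variety_irreducible _ _ W)).
have [L [g [kerg gfrac]]] := residue_field (A := kmpoly K (e * n)) Wid Wpr.
pose f : {lrmorphism K -> L} := g \o kmpolyC.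
pose w : 'rV[L]_(e * n) := \row_i g (kmpolyX i).
have gE : g =1 kmeval f (w 0).
  apply: (kmpoly_ext (g := kmeval f (w 0))) => [c|i] /=; first by rewrite kmevalC.
  by rewrite kmevalX mxE.
(* Stability of the ideal of W comes from the hypothesis at the generic point w. *)
have kerD p : g p = 0 -> tens_map g (poly_coact D p) = 0 :> tens b L.
  move=> gp; rewrite (eq_tens_map _ gE) kmeval_poly_coact.
  apply: (Wc L f w); last by rewrite -kerg gp.
  by move=> q Wq; rewrite -[LHS]gE; apply/eqP; rewrite kerg.
have kerD' p : g p = 0 -> tens_map g (poly_gring D n p) = 0 :> tens b L by exact: kerD.
pose DL := loc_gring kerD' gfrac.
have gD : gmorphism (poly_gring D n) DL g := loc_gmorphism kerD' gfrac.
pose x : 'rV[L]_n := \row_j g (generic_coord G K j).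
exists L, DL, f, x; split=> [c|p Wp].
  by rewrite /= gD /= poly_coactC tens_map_comp.
(* A g-morphism out of A is determined by the images of the generators: the coordinate w_(i,j) must
   be the i-th component of D x_j. *)
suff -> : nabla_point DL x = w by rewrite -gE; apply/eqP; rewrite kerg.
apply/rowP => i; case/mxvec_indexP: i => i j.
rewrite nabla_pointE !mxE gD tens_mapE /generic_coord -tens_map_eval.
by rewrite [X in tens_eval _ X]poly_coact_pack tens_eval_comul packE mxE.
Qed.

Lemma existentially_closed_geometric :
  existentially_closed D -> geometric_axioms D.
Proof.
move=> ecD n V W _ subVW Wc.
have [L [DL [f [x [fD xW]]]]] := generic_extension Wc.
have [[_ _ Wcl] _] := variety_reduced W.
have [gs [gsW gsgen]] := hilbert_basis Wcl.
have [a aP] := ec_finite_zeros ecD fD (fun p gp => xW p (gsW p gp)).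
have aW : points W (idfun : {lrmorphism K -> K}) (nabla_point D a).
  move=> p /gsgen[c ->]; rewrite -[LHS]/(kmeval _ _ _) linear_sum big1 // => i _.
  by rewrite rmorphM /= (aP gs`_i) ?mulr0 // mem_nth.
exists a; split=> // p Vp.
(* Since nabla a lies in W <= nabla V, one has D(p(a)) = 0, and the counit recovers p(a) = 0. *)
have : kmeval (twist D idfun) (pack b (nabla_point D a) 0) p = 0.
  exact: subVW aW p Vp.
rewrite (kmeval_nabla (idfun_gmorphism D)).
by move=> /(congr1 (tens_eval (counit G))); rewrite coact_counit rmorph0.
Qed.

End Existence.

Unset Implicit Arguments.

Theorem theorem3p6 (k : fieldType) (H : finComAlgType k) (d : nat)
    (b : kbasis H d.+1) (G : hopf b)
    (counit_b0 : counit G b`_0 = 1)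
    (counit_b : forall i : 'I_d, counit G b`_i.+1 = 0)
    (K : fieldAlgType k) (D : gring G K) :
  existentially_closed D <-> geometric_axioms D.
Proof.
split; first exact: existentially_closed_geometric.
exact: geometric_existentially_closed.
Qed.
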